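(* Let $\mathbb{P}$ be a radial determinantal point process on $(\mathbb{R}^d,dx)$, $d\ge1$, governed by a locally trace class orthogonal projection operator $\mathcal{K}$ on $L^2(\mathbb{R}^d,dx)$ whose kernel is normalized so that $K(x,x)=1$ for almost all $x$. Let $\Lambda\subset\mathbb{R}^d$ be a bounded open set with positive Lebesgue measure. Then $\mathbb{P}$ is hyperuniform along $\{R\Lambda\}_{R>0}$, that is, $$\lim_{R\to+\infty}\mathbb{E}[\Xi(R\Lambda)]=\infty,\qquad\lim_{R\to+\infty}\frac{\mathrm{var}(\Xi(R\Lambda))}{\mathbb{E}[\Xi(R\Lambda)]}=0.$$
   Context: $L^2(\mathbb{R}^d,dx)$ is the complex Hilbert space for Lebesgue measure; $R\Lambda=\{Rx:x\in\Lambda\}$. An operator $\mathcal{K}$ is locally trace class if $\mathcal{P}_\Lambda\mathcal{K}\mathcal{P}_\Lambda$ is trace class for every bounded Borel $\Lambda\subset\mathbb{R}^d$, where $\mathcal{P}_\Lambda f=\mathbf{1}_\Lambda f$; it then has a kernel $K$, i.e. $\mathcal{K}f(x)=\int K(x,y)f(y)\,dy$. For an orthogonal projection $\mathcal{K}$, the kernel is taken so that, on a Borel set of full measure, $K(x,y)=\overline{K(y,x)}$ and the reproducing property $\int K(x,y)K(y,z)\,dy=K(x,z)$ holds. A configuration $\Xi$ is a non-negative-integer-valued Radon measure on $\mathbb{R}^d$; it is simple if $\Xi(\{x\})\in\{0,1\}$ for all $x$. A simple point process $\mathbb{P}$ is a probability measure on the space of configurations supported on simple ones; $\mathbb{E}$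 and $\mathrm{var}$ are taken under $\mathbb{P}$. The $n$-th correlation function $\rho_n$ is defined by $\mathbb{E}\big[\sum^*_{x_1,\dots,x_n\in\mathrm{supp}\,\Xi}f(x_1,\dots,x_n)\big]=\int f\rho_n\,dx_1\cdots dx_n$ for all measurable compactly supported $f$, the sum being over pairwise distinct points. The determinantal point process governed by $\mathcal{K}$ is the simple point process with $\rho_n(x_1,\dots,x_n)=\det(K(x_i,x_j))_{i,j=1}^n$ for all $n$; it is known to exist for every locally trace class orthogonal projection. It is radial if there is a function $\varphi:[0,+\infty)\to[0,+\infty)$ with $|K(x,y)|^2=\varphi(\|x-y\|)$ for almost all $x,y\in\mathbb{R}^d$, where $\|\cdot\|$ is the Euclidean norm. *)

(* Defs.v *)
From HB Require Import structures.
From mathcomp Require Import all_boot all_order all_algebra.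
From mathcomp Require Import all_classical all_reals all_analysis.
From mathcomp Require Import measurable_realfun complex.

Set Implicit Arguments.
Unset Strict Implicit.
Unset Printing Implicit Defensive.

Import Order.TTheory GRing.Theory Num.Theory.
Import numFieldNormedType.Exports.

Local Open Scope classical_set_scope.
Local Open Scope ring_scope.

Section cons_measure.
Context d (T : measurableType d) (R : realType) (n : nat).
Variable mu : {sigma_finite_measure set T -> \bar R}.
Variable nu : {sigma_finite_measure set (n.-tuple T) -> \bar R}.

Let consf (p : T * n.-tuple T) : n.+1.-tuple T := [tuple of p.1 :: p.2].

Definition cons_measure (A : set (n.+1.-tuple T)) : \bar R :=
  (mu \x nu)%E (consf @^-1` A).

Let measurable_consf A : measurable A -> measurable (consf @^-1` A).
Proof.
move=> mA; rewrite -[X in measurable X]setTI.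
exact: (measurable_cons measurable_fst measurable_snd).
Qed.

Let cons_measure0 : cons_measure set0 = 0%E.
Proof. by rewrite /cons_measure preimage_set0 measure0. Qed.

Let cons_measure_ge0 A : (0 <= cons_measure A)%E.
Proof. exact: measure_ge0. Qed.

Let cons_measure_sigma_additive : semi_sigma_additive cons_measure.
Proof.
move=> F mF tF mUF; rewrite /cons_measure preimage_bigcup.
apply: measure_semi_sigma_additive.
- by move=> i; exact: measurable_consf.
- apply/trivIsetP => /= i j _ _ ij; rewrite -preimage_setI.
  by move/trivIsetP : tF => /(_ _ _ _ _ ij) ->//; rewrite preimage_set0.
- by rewrite -preimage_bigcup; exact: measurable_consf.
Qed.

HB.instance Definition _ := isMeasure.Build _ _ _ cons_measure
  cons_measure0 cons_measure_ge0 cons_measure_sigma_additive.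

Lemma cons_measureX (A : set T) (B : set (n.-tuple T)) :
  measurable A -> measurable B ->
  cons_measure [set t | A (thead t) /\ B [tuple of behead t]] =
  (mu A * nu B)%E.
Proof.
move=> mA mB; rewrite -product_measure1E//; congr product_measure1.
apply/seteqP; split=> -[x t] /=.
all: by rewrite theadE (_ : [tuple of behead (consf (x, t))] = t)//; exact: val_inj.
Qed.

Lemma measurable_cons_set (A : set T) (B : set (n.-tuple T)) :
  measurable A -> measurable B ->
  measurable [set t : n.+1.-tuple T | A (thead t) /\ B [tuple of behead t]].
Proof.
move=> mA mB.
rewrite (_ : [set t | _] = (@tnth _ T ^~ ord0) @^-1` A `&`
  (fun t : n.+1.-tuple T => [tuple of behead t]) @^-1` B)//.
apply: measurableI; rewrite -[X in measurable X]setTI.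
- exact: measurable_tnth.
- exact: measurable_behead.
Qed.

Let cons_measure_sigma_finite : sigma_finite [set: n.+1.-tuple T] cons_measure.
Proof.
have /sigma_finiteP[F [FT ndF Foo]] := sigma_finiteT mu.
have /sigma_finiteP[G [GT ndG Goo]] := sigma_finiteT nu.
exists (fun k => [set t | F k (thead t) /\ G k [tuple of behead t]]).
  apply/seteqP; split=> // t _.
  have [i _ Fi] : (\bigcup_i F i) (thead t) by rewrite -FT.
  have [j _ Gj] : (\bigcup_j G j) [tuple of behead t] by rewrite -GT.
  exists (maxn i j) => //; split.
  - by move: (thead t) Fi; exact/subsetPset/ndF/leq_maxl.
  - by move: [tuple of behead t] Gj; exact/subsetPset/ndG/leq_maxr.
move=> k; have [mF Fk] := Foo k; have [mG Gk] := Goo k; split.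
  exact: measurable_cons_set.
by rewrite cons_measureX// lte_mul_pinfty// ge0_fin_numE.
Qed.

HB.instance Definition _ := Measure_isSigmaFinite.Build _ _ _ cons_measure
  cons_measure_sigma_finite.

End cons_measure.

Section power_measure.
Context d (T : measurableType d) (R : realType).
Variable mu : {sigma_finite_measure set T -> \bar R}.

Fixpoint power_measure n : {sigma_finite_measure set (n.-tuple T) -> \bar R} :=
  match n with
  | 0 => \d_([tuple] : 0.-tuple T)
  | n'.+1 => cons_measure mu (power_measure n')
  end.

End power_measure.

Section borel_matrix.
Context (R : realType) (m n : nat).

HB.instance Definition _ := @isMeasurable.Build
  (sigma_display (@open 'M[R]_(m, n))) 'M[R]_(m, n) <<s @open 'M[R]_(m, n) >>
  (@sigma_algebra0 _ setT _) (@sigma_algebraC _ _)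
  (@sigma_algebra_bigcup _ setT _).

End borel_matrix.

Lemma measurable_mx_open (R : realType) (m n : nat) (U : set 'M[R]_(m, n)) :
  open U -> measurable U.
Proof. exact: sub_sigma_algebra. Qed.

Section lebesgue_rV.
Context (R : realType) (n : nat).

Let rV_of_tuple (t : n.-tuple (measurableTypeR R)) : 'rV[R]_n :=
  \row_i tnth t i.
Let tuple_of_rV (v : 'rV[R]_n) : n.-tuple (measurableTypeR R) :=
  [tuple v ord0 i | i < n].

Let rV_of_tupleK : cancel rV_of_tuple tuple_of_rV.
Proof. by move=> t; apply: eq_from_tnth => i; rewrite tnth_mktuple mxE. Qed.

Let measurable_rV_of_tuple (A : set 'rV[R]_n) :
  measurable A -> measurable (rV_of_tuple @^-1` A).
Proof.
rewrite -[rV_of_tuple @^-1` A]setTI; move: A; apply: measurability => //.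
move=> _ [U oU <-]; rewrite setTI.
pose box (qk : n.-tuple rat * nat) : set 'rV[R]_n :=
  [set v | forall i, `|v ord0 i - ratr (tnth qk.1 i)| < qk.2.+1%:R^-1].
have -> : U = \bigcup_(qk in [set qk | box qk `<=` U]) box qk.
  apply/seteqP; split=> [v Uv|v [qk qkU]]; last exact: qkU.
  have /nbhs_ballP[e /= e0 eU] : nbhs v U by exact: open_nbhs_nbhs.
  have [k ke] : exists k, k.+1%:R^-1 < e / 2.
    exists (Num.truncn (e / 2)^-1).
    by rewrite invf_plt ?posrE ?divr_gt0// truncnS_gt.
  have k0 : 0 < k.+1%:R^-1 :> R by rewrite invr_gt0.
  have Hq i : {q : rat | ratr q \in `]v ord0 i, v ord0 i + k.+1%:R^-1[%R}.
    by apply/cid/rat_in_itvoo; rewrite ltrDl.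
  pose q := [tuple projT1 (Hq i) | i < n].
  have vq : box (q, k) v.
    move=> i /=; rewrite tnth_mktuple.
    have := projT2 (Hq i); rewrite in_itv/= => /andP[vi iv].
    by rewrite ltr0_norm ?subr_lt0// opprB ltrBlDl.
  exists (q, k) => // w wq; apply: eU; split=> // i j.
  rewrite ord1 /ball/=.
  rewrite (le_lt_trans (ler_distD (ratr (tnth q j)) _ _))//.
  rewrite [ltRHS]splitr ltrD//; first exact: lt_trans (vq j) ke.
  by rewrite distrC; exact: lt_trans (wq j) ke.
rewrite preimage_bigcup bigcup_mkcond.
apply: countable_bigcupT_measurable => // qk; case: ifPn => // _.
rewrite (_ : _ @^-1` _ = \bigcap_(i in [set: 'I_n]) (@tnth _ _ ^~ i) @^-1`
    ball (ratr (tnth qk.1 i) : R) qk.2.+1%:R^-1).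
  apply: fin_bigcap_measurable => // i _.
  rewrite -[X in measurable X]setTI; apply: measurable_tnth => //.
  by apply: open_measurable; exact: ball_open.
apply/seteqP; split=> [t tqk i _|t tqk i].
  by have := tqk i; rewrite mxE /ball/= distrC.
by rewrite mxE distrC; exact: tqk.
Qed.

Let measurable_tuple_of_rV (A : set (n.-tuple (measurableTypeR R))) :
  measurable A -> measurable (tuple_of_rV @^-1` A).
Proof.
rewrite -[tuple_of_rV @^-1` A]setTI => mA.
suff : measurable_fun [set: 'rV[R]_n] tuple_of_rV by apply.
apply/measurable_fun_tnthP => i.
rewrite (_ : _ \o _ = fun v : 'rV[R]_n => v ord0 i); last first.
  by apply/funext => v /=; rewrite tnth_mktuple.
apply: (measurability _ (RGenOpens.measurableE R)) => _ /= [_ [a [b ->]] <-].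
have oab : open `]a, b[%classic by exact: interval_open.
rewrite setTI; apply: measurable_mx_open.
by apply: open_comp => // v _; exact: coord_continuous.
Qed.

Definition lebesgue_rV (A : set 'rV[R]_n) : \bar R :=
  power_measure (@lebesgue_measure R) n (rV_of_tuple @^-1` A).

Let lebesgue_rV0 : lebesgue_rV set0 = 0%E.
Proof. by rewrite /lebesgue_rV preimage_set0 measure0. Qed.

Let lebesgue_rV_ge0 A : (0 <= lebesgue_rV A)%E.
Proof. exact: measure_ge0. Qed.

Let lebesgue_rV_sigma_additive : semi_sigma_additive lebesgue_rV.
Proof.
move=> F mF tF mUF; rewrite /lebesgue_rV preimage_bigcup.
apply: measure_semi_sigma_additive.
- by move=> i; exact: measurable_rV_of_tuple.
- apply/trivIsetP => /= i j _ _ ij; rewrite -preimage_setI.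
  by move/trivIsetP : tF => /(_ _ _ _ _ ij) ->//; rewrite preimage_set0.
- by rewrite -preimage_bigcup; exact: measurable_rV_of_tuple.
Qed.

HB.instance Definition _ := isMeasure.Build _ _ _ lebesgue_rV
  lebesgue_rV0 lebesgue_rV_ge0 lebesgue_rV_sigma_additive.

Let lebesgue_rV_sigma_finite : sigma_finite [set: 'rV[R]_n] lebesgue_rV.
Proof.
have [F FT Foo] := sigma_finiteT (power_measure (@lebesgue_measure R) n).
exists (fun k => tuple_of_rV @^-1` F k).
  by rewrite -preimage_bigcup -FT preimage_setT.
move=> k; have [mF Fk] := Foo k; split; first exact: measurable_tuple_of_rV.
rewrite /lebesgue_rV -comp_preimage (_ : tuple_of_rV \o rV_of_tuple = id)//.
by apply/funext => t /=; rewrite rV_of_tupleK.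
Qed.

HB.instance Definition _ := Measure_isSigmaFinite.Build _ _ _ lebesgue_rV
  lebesgue_rV_sigma_finite.

End lebesgue_rV.
Arguments lebesgue_rV {R n}.

Section complex_integral.
Context d (T : measurableType d) (R : realType).
Variable mu : {measure set T -> \bar R}.
Implicit Type f : T -> R[i].

Definition cmeasurable f :=
  measurable_fun [set: T] (fun x => complex.Re (f x)) /\
  measurable_fun [set: T] (fun x => complex.Im (f x)).

Definition cintegrable f :=
  mu.-integrable [set: T] (fun x => (complex.Re (f x))%:E) /\
  mu.-integrable [set: T] (fun x => (complex.Im (f x))%:E).

Definition cintegral f : R[i] :=
  Complex (\int[mu]_x complex.Re (f x)) (\int[mu]_x complex.Im (f x)).

End complex_integral.

(* Elements of the complex space L^2(mu) are represented by functions, and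
   operators on L^2(mu) by maps on functions that respect equality a.e. *)
Section L2.
Context d (T : measurableType d) (R : realType).
Variable mu : {measure set T -> \bar R}.
Implicit Types f g : T -> R[i].
Implicit Types A B : (T -> R[i]) -> (T -> R[i]).

Definition L2 f :=
  cmeasurable f /\ (\int[mu]_x (Normc.normc (f x) ^+ 2)%:E < +oo)%E.

Definition inner f g : R[i] := cintegral mu (fun x => f x * conjc (g x)).

Definition norm2 f : R := Num.sqrt (\int[mu]_x (Normc.normc (f x) ^+ 2)).

Record bounded_operator A : Prop := BoundedOperator {
  operator_L2 : forall f, L2 f -> L2 (A f) ;
  operator_ae : forall f g, L2 f -> L2 g -> f = g %[ae mu] ->
    A f = A g %[ae mu] ;
  operator_linear : forall (c : R[i]) f g, L2 f -> L2 g ->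
    \forall x \ae mu, A (fun y => c * f y + g y) x = c * A f x + A g x ;
  operator_bounded : exists M : R, forall f, L2 f ->
    norm2 (A f) <= M * norm2 f
}.

Definition orthogonal_projection A :=
  [/\ bounded_operator A,
      forall f, L2 f -> A (A f) = A f %[ae mu] &
      forall f g, L2 f -> L2 g -> inner (A f) g = inner f (A g)].

(* The order of R[i] makes 0 <= z mean that z is real and nonnegative. *)
Definition positive_operator A :=
  bounded_operator A /\ forall f, L2 f -> 0 <= inner (A f) f.

(* B = |A|: B is positive and B^2 = A^* A. *)
Definition operator_abs A B :=
  positive_operator B /\
  forall f g, L2 f -> L2 g -> inner (B (B f)) g = inner (A f) (A g).

(* L^2(R^d) is separable and infinite-dimensional when d > 0, so its
   orthonormal bases can be indexed by nat. *)
Definition orthonormal_basis (e : nat -> T -> R[i]) :=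
  [/\ forall n, L2 (e n),
      forall m n, inner (e m) (e n) = (m == n)%:R &
      forall f, L2 f -> (forall n, inner f (e n) = 0) -> f = cst 0 %[ae mu]].

Definition trace_class A :=
  bounded_operator A /\
  exists B, operator_abs A B /\
  exists e, orthonormal_basis e /\
    (\sum_(0 <= n <oo) (complex.Re (inner (B (e n)) (e n)))%:E < +oo)%E.

End L2.

Section operators_rV.
Context (R : realType) (d : nat).
Local Notation V := 'rV[R]_d.
Local Notation leb := (@lebesgue_rV R d).
Implicit Types (A : (V -> R[i]) -> (V -> R[i])) (K : V -> V -> R[i]).

Definition restriction (L : set V) (f : V -> R[i]) : V -> R[i] :=
  fun x => real_complex R (\1_L x) * f x.

Definition locally_trace_class A :=
  forall L : set V, measurable L -> bounded_set L ->
    trace_class leb (fun f => restriction L (A (restriction L f))).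

Definition kernel_of A K :=
  cmeasurable (fun xy : V * V => K xy.1 xy.2) /\
  forall f, L2 leb f -> \forall x \ae leb,
    cintegrable leb (fun y => K x y * f y) /\
    A f x = cintegral leb (fun y => K x y * f y).

(* The choice of the kernel of a projection: it is Hermitian and reproducing on
   a Borel set of full measure, which fixes its values on the diagonal a.e. *)
Definition projection_kernel A K :=
  kernel_of A K /\
  exists D : set V, [/\ measurable D, leb (~` D) = 0%E,
    forall x y, D x -> D y -> K x y = conjc (K y x) &
    forall x z, D x -> D z ->
      cintegrable leb (fun y => K x y * K y z) /\
      cintegral leb (fun y => K x y * K y z) = K x z].

Definition euclidean_norm (x : V) : R := Num.sqrt (\sum_i x ord0 i ^+ 2).

Definition radial K :=
  exists phi : R -> R, (forall r, 0 <= r -> 0 <= phi r) /\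
    \forall xy \ae (leb \x leb)%E,
      Normc.normc (K xy.1 xy.2) ^+ 2 = phi (euclidean_norm (xy.1 - xy.2)).

End operators_rV.

Section configuration.
Context (R : realType) (d : nat).
Local Notation V := 'rV[R]_d.

Record configuration := Configuration {
  configuration_measure :> {measure set V -> \bar R} ;
  configuration_nat : forall A : set V, measurable A ->
    configuration_measure A = +oo%E \/
    exists n : nat, configuration_measure A = n%:R%:E ;
  configuration_locally_finite : forall A : set V, compact A ->
    (configuration_measure A < +oo)%E
}.

Let mzero_nat (A : set V) : measurable A ->
  (@mzero _ V R) A = +oo%E \/ exists n : nat, (@mzero _ V R) A = n%:R%:E.
Proof. by move=> _; right; exists 0%N. Qed.

Let mzero_locally_finite (A : set V) : compact A -> ((@mzero _ V R) A < +oo)%E.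
Proof. by move=> _; exact: ltry. Qed.

HB.instance Definition _ := gen_eqMixin configuration.
HB.instance Definition _ := gen_choiceMixin configuration.
HB.instance Definition _ := isPointed.Build configuration
  (@Configuration (@mzero _ V R) mzero_nat mzero_locally_finite).

Definition evaluation_sets : set (set configuration) :=
  \bigcup_(A in [set A : set V | measurable A])
    preimage_set_system [set: configuration]
      (fun Xi : configuration => Xi A) measurable.

HB.instance Definition _ := @isMeasurable.Build
  (sigma_display evaluation_sets) configuration <<s evaluation_sets >>
  (@sigma_algebra0 _ setT _) (@sigma_algebraC _ _)
  (@sigma_algebra_bigcup _ setT _).

Definition simple_configuration (Xi : configuration) :=
  forall x : V, Xi [set x] = 0%E \/ Xi [set x] = 1%E.

Definition supp (Xi : configuration) : set V :=
  [set x | forall U : set V, open U -> U x -> (0 < Xi U)%E].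

(* Xi A is finite for bounded Borel A, so fine loses nothing there. *)
Definition npoints (A : set V) (Xi : configuration) : R := fine (Xi A).

Definition distinct_sum n (f : n.-tuple V -> R) (Xi : configuration) : \bar R :=
  \esum_(x in [set x : n.-tuple V |
                uniq x /\ forall i, supp Xi (tnth x i)]) (f x)%:E.

End configuration.

Section point_process.
Context (R : realType) (d : nat).
Local Notation V := 'rV[R]_d.
Local Notation leb := (@lebesgue_rV R d).
Variable P : probability (configuration R d) R.

Definition simple_point_process := \forall Xi \ae P, simple_configuration Xi.

(* n.-tuple V carries no topology: a compact set of V^n lies in some C^n. *)
Definition compactly_supported n (f : n.-tuple V -> R) :=
  exists2 C : set V, compact C &
    forall x, (exists i, ~ C (tnth x i)) -> f x = 0.

(* Only nonnegative f are tested: both sides then always make sense in [0, +oo],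
   and the identity for integrable f of any sign follows by linearity. *)
Definition correlation_function n (rho : n.-tuple V -> R) :=
  [/\ measurable_fun [set: n.-tuple V] rho, forall x, 0 <= rho x &
      forall f : n.-tuple V -> R,
        measurable_fun [set: n.-tuple V] f -> (forall x, 0 <= f x) ->
        compactly_supported f ->
        (\int[P]_Xi distinct_sum f Xi =
         \int[power_measure leb n]_x (f x * rho x)%:E)%E].

(* A correlation function is determined up to a null set, whence the a.e.
   identification with the determinant (a priori a complex number). *)
Definition determinantal (K : V -> V -> R[i]) :=
  simple_point_process /\
  forall n, (0 < n)%N -> exists rho : n.-tuple V -> R,
    correlation_function rho /\
    \forall x \ae power_measure leb n,
      real_complex R (rho x) = \det (\matrix_(i, j) K (tnth x i) (tnth x j)).

End point_process.

(* Main.v *)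
Require Import Defs.
From HB Require Import structures.
From mathcomp Require Import all_boot all_order all_algebra.
From mathcomp Require Import all_classical all_reals all_analysis.
From mathcomp Require Import measurable_realfun complex ring lra.
Import Order.TTheory GRing.Theory Num.Theory.
Import numFieldNormedType.Exports.
Local Open Scope classical_set_scope.
Local Open Scope ring_scope.
Set Implicit Arguments.
Unset Strict Implicit.
Unset Printing Implicit Defensive.

(** Write [k x y = |K(x, y)|^2] and [A = R Lambda]. The first two correlation
    functions give [E = |A|] and [E N(N-1) = |A|^2 - \int_A \int_A k], and the
    reproducing property gives [\int k(x, y) dy = K(x, x) = 1], so that
    [var = \int_A \int_(A^c) k]. Radiality makes [k(x, y) = g(y - x)] for an
    integrable [g], and rescaling by [R] turns [var / E] into
    [|Lambda|^-1 \int_Lambda \int 1_(Lambda^c)(x + z / R) g(z) dz dx], which tends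
    to 0 by dominated convergence because [Lambda] is open. *)

(** Measurability is the main obstacle. [distinct_sum] as a function of the configuration and the
    radial profile [phi] are not known to be measurable, so equalities of integrals pass through
    [ge0_integral_ae_measurable], which asks for measurability on one side only. Integrals take
    values in [\bar R]. Moment identities are therefore stated as sums of nonnegative terms, and
    differences are formed in [R] once finiteness is known. Correlation functions see only sums over
    distinct support points. These sums equal [Xi A] and [Xi A * (Xi A - 1)] because integer values
    and simplicity make every support point an atom of mass one. In the limit, a boundary of
    [Lambda] of positive measure is harmless: the outer integral runs over [Lambda] itself, and for
    [x] in the open set [Lambda] and fixed [z], the point [x + z / R] lies in [Lambda] as soon as
    [R] is large. *)

(** * Borel sets and measurable maps of row vectors, through rational cubes *)

Section rat_box.
Context (R : realType) (n : nat).
Implicit Types U : set 'rV[R]_n.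

(** The index type is countable, so unions of such cubes stay measurable and unions of null cubes
    stay null. *)
Definition rat_box (qk : n.-tuple rat * nat) : set 'rV[R]_n :=
  [set v | forall i, `|v ord0 i - ratr (tnth qk.1 i)| < qk.2.+1%:R^-1].

Lemma rat_box_bigcap qk : rat_box qk =
  \bigcap_(i in [set: 'I_n])
    (fun v => v ord0 i) @^-1` ball (ratr (tnth qk.1 i) : R) qk.2.+1%:R^-1.
Proof.
apply/seteqP; split=> [v qkv i _|v qkv i]; first by rewrite /ball/= distrC.
by rewrite distrC; exact: qkv.
Qed.

Lemma open_bigcup_rat_box U : open U ->
  U = \bigcup_(qk in [set qk | rat_box qk `<=` U]) rat_box qk.
Proof.
move=> oU; apply/seteqP; split=> [v Uv|v [qk qkU]]; last exact: qkU.
have /nbhs_ballP[e /= e0 eU] : nbhs v U by exact: open_nbhs_nbhs.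
(* Half of [e], since a point of the cube and [v] are compared through the rational centre, each
   within [k.+1%:R^-1] of it. *)
have [k ke] : exists k, k.+1%:R^-1 < e / 2.
  exists (Num.truncn (e / 2)^-1).
  by rewrite invf_plt ?posrE ?divr_gt0// truncnS_gt.
have Hq i : {q : rat | ratr q \in `]v ord0 i, v ord0 i + k.+1%:R^-1[%R}.
  by apply/cid/rat_in_itvoo; rewrite ltrDl invr_gt0.
have vq : rat_box ([tuple projT1 (Hq i) | i < n], k) v.
  move=> i /=; rewrite tnth_mktuple.
  have := projT2 (Hq i); rewrite in_itv/= => /andP[vi iv].
  by rewrite ltr0_norm ?subr_lt0// opprB ltrBlDl.
exists ([tuple projT1 (Hq i) | i < n], k) => // w wq; apply: eU; split=> // i j.
rewrite ord1 /ball/=.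
rewrite (le_lt_trans (ler_distD (ratr (tnth [tuple projT1 (Hq i) | i < n] j)) _ _))//.
rewrite [ltRHS]splitr ltrD//; first exact: lt_trans (vq j) ke.
by rewrite distrC; exact: lt_trans (wq j) ke.
Qed.

Lemma measurable_fun_coord i :
  measurable_fun [set: 'rV[R]_n] (fun v : 'rV[R]_n => v ord0 i : measurableTypeR R).
Proof.
apply: (measurability _ (RGenOpens.measurableE R)) => _ /= [_ [a [b ->]] <-].
rewrite setTI; apply: measurable_mx_open; apply: open_comp; last exact: interval_open.
by move=> v _; exact: coord_continuous.
Qed.

Lemma measurable_rat_box qk : measurable (rat_box qk).
Proof.
rewrite rat_box_bigcap; apply: fin_bigcap_measurable => // i _.
rewrite -[X in measurable X]setTI; apply: measurable_fun_coord => //.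
by apply: open_measurable; exact: ball_open.
Qed.

(** Preimages of open sets suffice. An open set is a countable union of rational cubes, and a cube
    is a finite intersection of conditions on single coordinates. *)
Lemma measurable_fun_rV d (T : measurableType d) (f : T -> 'rV[R]_n) :
  (forall i, measurable_fun [set: T] (fun x => f x ord0 i : measurableTypeR R)) ->
  measurable_fun [set: T] f.
Proof.
move=> mf; apply: measurability => // _ [U oU <-].
rewrite setTI (open_bigcup_rat_box oU) preimage_bigcup bigcup_mkcond.
apply: countable_bigcupT_measurable => // qk; case: ifPn => // _.
rewrite rat_box_bigcap preimage_bigcap; apply: fin_bigcap_measurable => // i _.
rewrite -[X in measurable X]setTI -comp_preimage; apply: mf => //.
by apply: open_measurable; exact: ball_open.
Qed.

Lemma measurable_affine (c : R) (b : 'rV[R]_n) :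
  measurable_fun [set: 'rV[R]_n] (fun v => c *: v + b).
Proof.
apply: measurable_fun_rV => i; under eq_fun do rewrite !mxE.
apply: measurable_funD => //; apply: measurable_funM => //.
exact: measurable_fun_coord.
Qed.

Lemma measurable_fun_addrV d (T : measurableType d) (f g : T -> 'rV[R]_n) :
  measurable_fun [set: T] f -> measurable_fun [set: T] g ->
  measurable_fun [set: T] (fun x => f x + g x).
Proof.
move=> mf mg; apply: measurable_fun_rV => i; under eq_fun do rewrite mxE.
apply: measurable_funD.
- exact: (measurableT_comp (measurable_fun_coord i) mf).
- exact: (measurableT_comp (measurable_fun_coord i) mg).
Qed.

Lemma measurable_fun_scalerV d (T : measurableType d) (c : R) (f : T -> 'rV[R]_n) :
  measurable_fun [set: T] f -> measurable_fun [set: T] (fun x => c *: f x).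
Proof.
move=> mf; apply: measurable_fun_rV => i; under eq_fun do rewrite mxE.
apply: measurable_funM => //.
exact: (measurableT_comp (measurable_fun_coord i) mf).
Qed.

End rat_box.

(** * Tonelli's theorem for measures on tuples *)

Section cons_measure_integral.
Context d (T : measurableType d) (R : realType) (n : nat).
Variable mu : {sigma_finite_measure set T -> \bar R}.
Variable nu : {sigma_finite_measure set (n.-tuple T) -> \bar R}.
Local Open Scope ereal_scope.

Let consf (p : T * n.-tuple T) : n.+1.-tuple T := [tuple of p.1 :: p.2].

Lemma measurable_consf : measurable_fun [set: T * n.-tuple T] consf.
Proof. exact: (measurable_cons measurable_fst measurable_snd). Qed.

Lemma cons_measureE (A : set (n.+1.-tuple T)) :
  cons_measure mu nu A =
  \int[mu]_x nu [set t : n.-tuple T | A [tuple of x :: t]].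
Proof.
rewrite /cons_measure /product_measure1; apply: eq_integral => x _ /=.
by congr (nu _); apply/seteqP; split=> t; rewrite /xsection /= inE.
Qed.

Lemma ge0_integral_cons_measure (f : n.+1.-tuple T -> \bar R) :
  measurable_fun [set: n.+1.-tuple T] f -> (forall t, 0 <= f t) ->
  \int[cons_measure mu nu]_t f t =
  \int[mu]_x \int[nu]_t f [tuple of x :: t].
Proof.
move=> mf f0.
transitivity (\int[mu \x nu]_p (f \o consf) p).
  have := @ge0_integral_pushforward _ _ _ _ R consf measurable_consf (mu \x nu)
    setT f measurableT mf (fun y _ => f0 y).
  by rewrite preimage_setT => <-.
rewrite fubini_tonelli1//.
  by apply: measurableT_comp => //; exact: measurable_consf.
by move=> p; exact: f0.
Qed.

Lemma measurable_cons_section (A : set (n.+1.-tuple T)) x : measurable A ->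
  measurable [set t : n.-tuple T | A [tuple of x :: t]].
Proof.
move=> mA; have mcA : measurable (consf @^-1` A).
  by rewrite -[X in measurable X]setTI; exact: measurable_consf.
rewrite (_ : [set t | _] = xsection (consf @^-1` A) x).
  exact: measurable_xsection.
by apply/seteqP; split=> t; rewrite /xsection /= inE.
Qed.

Lemma measurable_fun_cons_section (A : set (n.+1.-tuple T)) : measurable A ->
  measurable_fun [set: T] (fun x => nu [set t : n.-tuple T | A [tuple of x :: t]]).
Proof.
move=> mA; have mcA : measurable (consf @^-1` A).
  by rewrite -[X in measurable X]setTI; exact: measurable_consf.
rewrite (_ : (fun x => _) = nu \o xsection (consf @^-1` A)).
  exact: measurable_fun_xsection.
apply/funext => x /=; congr (nu _).
by apply/seteqP; split=> t; rewrite /xsection /= inE.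
Qed.

End cons_measure_integral.

(** * Lebesgue measure under dilations and translations, and on bounded sets *)

Section affine.
Context (R : realType).
Local Open Scope ereal_scope.

(** By uniqueness of Lebesgue measure: [c] times its image under the affine map gives every
    half-open interval its length. *)
Lemma lebesgue_measure_affine (c b : R) (A : set (measurableTypeR R)) :
  (0 < c)%R -> measurable A ->
  lebesgue_measure ((fun x => c * x + b)%R @^-1` A) =
  (c^-1)%:E * lebesgue_measure A.
Proof.
move=> c0 mA.
have c0' : (0 <= c)%R by exact: ltW.
have mf : measurable_fun [set: measurableTypeR R]
    ((fun x => c * x + b)%R : measurableTypeR R -> measurableTypeR R).
  by apply: measurable_funD => //; apply: measurable_funM.
pose m := mscale (NngNum c0')
  (pushforward (@lebesgue_measure R)
     ((fun x => c * x + b)%R : measurableTypeR R -> measurableTypeR R)).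
have E : lebesgue_measure A = m mf A.
  apply: lebesgue_measure_unique => // _ [[x y]] _ <-.
  transitivity (c%:E * lebesgue_measure
    ((fun z : R => c * z + b)%R @^-1` `]x, y]%classic)); last by [].
  rewrite (_ : _ @^-1` _ = `](c^-1 * (x - b))%R, (c^-1 * (y - b))%R]%classic).
    rewrite !lebesgue_measure_itv/= !lte_fin ltr_pM2l ?invr_gt0// ltrD2r.
    case: ifPn => _; last by rewrite mule0.
    rewrite -!EFinB -EFinM -mulrBr mulrA divff ?gt_eqF// mul1r; congr EFin; ring.
  apply/seteqP; split=> z /=; rewrite !in_itv/= ltr_pdivrMl// ler_pdivlMl//;
    by rewrite ltrBlDr lerBrDr.
rewrite E (_ : m mf A = c%:E * lebesgue_measure
  ((fun z : R => c * z + b)%R @^-1` A))//.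
by rewrite muleA -EFinM mulVf ?gt_eqF// mul1e.
Qed.

Lemma ge0_integral_affine (c b : R) (f : measurableTypeR R -> \bar R) :
  (0 < c)%R -> measurable_fun [set: measurableTypeR R] f -> (forall x, 0 <= f x) ->
  \int[@lebesgue_measure R]_x f (c * x + b)%R =
  (c^-1)%:E * \int[@lebesgue_measure R]_x f x.
Proof.
move=> c0 mf f0.
have c0' : (0 <= c^-1)%R by rewrite invr_ge0 ltW.
pose phi : measurableTypeR R -> measurableTypeR R := (fun x => c * x + b)%R.
have mphi : measurable_fun [set: measurableTypeR R] phi.
  by apply: measurable_funD => //; apply: measurable_funM.
have := @ge0_integral_pushforward _ _ _ _ R phi mphi (@lebesgue_measure R)
    setT f measurableT mf (fun y _ => f0 y).
rewrite preimage_setT => <-.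
rewrite -(ge0_integral_mscale _ measurableT (NngNum c0'))//.
apply: eq_measure_integral => A mA _; exact: lebesgue_measure_affine.
Qed.

Definition affine_tuple (c : R) n (b t : n.-tuple (measurableTypeR R)) :
    n.-tuple (measurableTypeR R) :=
  [tuple c * tnth t i + tnth b i | i < n]%R.

Lemma power_measure_affine (c : R) n (b : n.-tuple (measurableTypeR R))
    (A : set (n.-tuple (measurableTypeR R))) :
  (0 < c)%R -> measurable A ->
  power_measure (@lebesgue_measure R) n (affine_tuple c b @^-1` A) =
  (c^-1 ^+ n)%:E * power_measure (@lebesgue_measure R) n A.
Proof.
move=> c0; elim: n b A => [|n IH] b A mA.
  rewrite expr0 mul1e; congr (_ _); apply/seteqP.
  by split=> t /=; rewrite (tuple0 t) (tuple0 (affine_tuple _ _ _)).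
rewrite [LHS]cons_measureE.
(* The slice at [x] of the preimage is the affine preimage of the slice of [A] at [c * x + thead b].
   The induction hypothesis yields [c^-1 ^+ n], and the outer integral the last factor. *)
pose h x := power_measure (@lebesgue_measure R) n
  [set t : n.-tuple (measurableTypeR R) | A [tuple of x :: t]].
rewrite (eq_integral (fun x : measurableTypeR R => (c^-1 ^+ n)%:E * h (c * x + thead b)%R)).
  rewrite ge0_integralZl//; last 2 first.
  - apply: (measurableT_comp (f:=h)); first exact: measurable_fun_cons_section.
    by apply: measurable_funD => //; apply: measurable_funM.
  - by rewrite lee_fin exprn_ge0// invr_ge0 ltW.
  rewrite ge0_integral_affine//; last exact: measurable_fun_cons_section.
  by rewrite /h -cons_measureE muleA -EFinM exprSr.
move=> x _; rewrite -(IH [tuple of behead b]); last exact: measurable_cons_section.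
congr (_ _); apply/seteqP; split=> t /=.
all: rewrite (_ : affine_tuple _ _ _ =
  [tuple of (c * x + thead b)%R :: affine_tuple c [tuple of behead b] t])//.
all: apply: eq_from_tnth => i; rewrite tnth_mktuple.
all: case: (unliftP ord0 i) => [j|] ->; rewrite ?tnthS ?tnth_mktuple//.
all: by rewrite [in LHS](tuple_eta b) tnthS.
Qed.

Lemma lebesgue_rV_affine d (c : R) (b : 'rV[R]_d) (A : set 'rV[R]_d) :
  (0 < c)%R -> measurable A ->
  lebesgue_rV ((fun v => c *: v + b)%R @^-1` A) = (c^-1 ^+ d)%:E * lebesgue_rV A.
Proof.
move=> c0 mA; rewrite /lebesgue_rV.
rewrite -(power_measure_affine [tuple b ord0 i | i < d])//.
  have E (t : d.-tuple (measurableTypeR R)) :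
      \row_i tnth (affine_tuple c [tuple b ord0 i | i < d] t) i =
      (c *: (\row_i tnth t i) + b)%R :> 'rV[R]_d.
    by apply/rowP => i; rewrite !mxE !tnth_mktuple.
  by congr (_ _); apply/seteqP; split=> t /=; rewrite E.
rewrite -[X in measurable X]setTI; apply: measurable_fun_rV => // i.
under eq_fun do rewrite mxE.
exact: measurable_tnth.
Qed.

Lemma ge0_integral_rV_affine d (c : R) (b : 'rV[R]_d) (f : 'rV[R]_d -> \bar R) :
  (0 < c)%R -> measurable_fun [set: 'rV[R]_d] f -> (forall x, 0 <= f x) ->
  \int[lebesgue_rV]_x f (c *: x + b)%R =
  (c^-1 ^+ d)%:E * \int[lebesgue_rV]_x f x.
Proof.
move=> c0 mf f0.
have c0' : (0 <= c^-1 ^+ d)%R by rewrite exprn_ge0// invr_ge0 ltW.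
have := @ge0_integral_pushforward _ _ _ _ R _ (measurable_affine c b)
    (@lebesgue_rV R d) setT f measurableT mf (fun y _ => f0 y).
rewrite preimage_setT => <-.
rewrite -(ge0_integral_mscale _ measurableT (NngNum c0'))//.
apply: eq_measure_integral => [|mf' A mA _]; first exact: measurable_affine.
exact: lebesgue_rV_affine.
Qed.

Lemma measurable_cube n (M : R) : measurable
  [set t : n.-tuple (measurableTypeR R) | forall i, `|tnth t i| <= M]%R.
Proof.
rewrite (_ : [set t | _] = \bigcap_(i in [set: 'I_n])
    (fun t : n.-tuple (measurableTypeR R) => tnth t i) @^-1` `[(- M)%R, M]%classic).
  apply: fin_bigcap_measurable => // i _; rewrite -[X in measurable X]setTI.
  exact: measurable_tnth.
apply/seteqP; split=> [t tM i _|t tM i]; first by rewrite /= in_itv/= -ler_norml.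
by have := tM i I; rewrite /= in_itv/= -ler_norml.
Qed.

Lemma power_measure_cube n (M : R) :
  power_measure (@lebesgue_measure R) n
    [set t : n.-tuple (measurableTypeR R) | forall i, `|tnth t i|%R <= M]%R < +oo.
Proof.
elim: n => [|n IH]; first by rewrite /= diracE ltry.
rewrite (_ : [set t | _] = [set t : n.+1.-tuple (measurableTypeR R) |
   `[(- M)%R, M]%classic (thead t) /\
   [set t : n.-tuple (measurableTypeR R) | forall i, `|tnth t i| <= M]%R
     [tuple of behead t]]).
  rewrite [ltLHS]cons_measureX//; last exact: measurable_cube.
  have L : @lebesgue_measure R `[(- M)%R, M]%classic < +oo.
    by rewrite lebesgue_measure_itv/=; case: ifP => _; rewrite ltry.
  apply: lte_mul_pinfty => //; rewrite ge0_fin_numE//; exact: L.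
apply/seteqP; split=> t /=; rewrite in_itv/= -ler_norml.
  move=> tM; split=> [|i]; first exact: tM.
  by have := tM (lift ord0 i); rewrite [in X in X -> _](tuple_eta t) tnthS.
move=> [t0 tM] i; rewrite (tuple_eta t).
by case: (unliftP ord0 i) => [j|] ->; rewrite ?tnthS.
Qed.

Lemma ler_coord_norm n (v : 'rV[R]_n) i : (`|v ord0 i| <= `|v|)%R.
Proof.
by rewrite [leRHS]/Num.norm /= mx_normrE; apply/bigmax_geP; right => /=; exists (ord0, i).
Qed.

Lemma lebesgue_rV_bounded d (A : set 'rV[R]_d) :
  measurable A -> bounded_set A -> lebesgue_rV A < +oo.
Proof.
(* [bounded_set] bounds the norm by every number strictly above [M], whence [M + 1]. *)
move=> mA [M [_ /(_ (M + 1)%R)]]; rewrite ltrDl ltr01 => /(_ isT) AM.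
apply: le_lt_trans (power_measure_cube d (M + 1)).
rewrite /lebesgue_rV le_measure ?inE//.
- rewrite -[X in measurable X]setTI; apply: measurable_fun_rV => // i.
  by under eq_fun do rewrite mxE; exact: measurable_tnth.
- exact: measurable_cube.
- move=> t /= /AM/= tM i; apply: le_trans tM.
  by rewrite (le_trans _ (ler_coord_norm _ i))// mxE.
Qed.

End affine.

(** * Simple configurations as counting measures of their supports *)

Lemma measure_bigcup_null d (T : measurableType d) (R : realType) (I : countType)
    (mu : {measure set T -> \bar R}) (F : I -> set T) :
  (forall i, measurable (F i)) -> (forall i, mu (F i) = 0%E) ->
  mu (\bigcup_i F i) = 0%E.
Proof.
(* The family is reindexed by [nat], with the empty set at the integers that encode no index. *)
move=> mF F0; pose G k := oapp F set0 (unpickle k).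
have -> : \bigcup_i F i = \bigcup_k G k.
  apply/seteqP; split=> [x [i _ Fx]|x [k _]].
    by exists (pickle i) => //; rewrite /G pickleK.
  by rewrite /G; case: unpickle => // i Fx; exists i.
apply: measure_negligible.
  by apply: bigcupT_measurable => k; rewrite /G; case: unpickle => [i|]/=.
apply: negligible_bigcup => k; rewrite /G; case: unpickle => [i|]/=.
  by apply/negligibleP; [exact: mF|exact: F0].
exact: negligible_set0.
Qed.

Section configuration.
Context (R : realType) (d : nat).
Local Notation V := 'rV[R]_d.
Variable Xi : configuration R d.
Local Open Scope ereal_scope.

Lemma measurable_mx_closed (A : set V) : closed A -> measurable A.
Proof.
move=> cA; rewrite -(setCK A); apply: measurableC; apply: measurable_mx_open.
exact: closed_openC.
Qed.

Lemma measurable_mx_set1 (x : V) : measurable [set x].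
Proof.
apply: measurable_mx_closed; apply: accessible_closed_set1.
exact/hausdorff_accessible/norm_hausdorff.
Qed.

(** Local finiteness and compact support are phrased with compact sets, whereas the sets to be
    counted are only bounded. *)
Lemma bounded_compact_hull (A : set V) : bounded_set A ->
  exists2 C : set V, compact C & A `<=` C.
Proof.
move=> [M [_ /(_ (M + 1)%R)]]; rewrite ltrDl ltr01 => /(_ isT) AM.
exists [set v | `|v| <= M + 1]%R; last exact: AM.
apply: bounded_closed_compact.
  by exists (M + 1)%R; split; [exact: num_real|move=> N MN v]; move=> /le_trans; apply; exact: ltW.
apply: (closed_comp (f := fun v : V => `|v|%R) (D := [set x | x <= M + 1]%R)).
  by move=> v _; exact: norm_continuous.
exact: closed_le.
Qed.

Lemma configuration_bounded (A : set V) :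
  measurable A -> bounded_set A -> Xi A < +oo.
Proof.
move=> mA /bounded_compact_hull[C cC AC].
apply: le_lt_trans (configuration_locally_finite Xi cC).
apply: le_measure; rewrite ?inE//.
by apply: measurable_mx_closed; apply: compact_closed => //; exact: norm_hausdorff.
Qed.

Lemma configuration_lt1 (A : set V) : measurable A -> Xi A < 1 -> Xi A = 0.
Proof.
move=> mA; case: (configuration_nat Xi mA) => [->//|[n ->]].
by rewrite lte_fin ltrn1 ltnS leqn0 => /eqP ->.
Qed.

Lemma open_rat_box (qk : d.-tuple rat * nat) : open (rat_box qk : set V).
Proof.
have -> : (rat_box qk : set V) = ~` (\bigcup_(i in [set: 'I_d])
    (fun v : V => v ord0 i) @^-1` (~` ball (ratr (tnth qk.1 i) : R) qk.2.+1%:R^-1)).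
  rewrite setC_bigcup rat_box_bigcap; apply: eq_bigcapr => i _.
  by rewrite -preimage_setC setCK.
apply: closed_openC; apply: closed_bigcup => [|i _]; first exact: finite_finset.
apply: closed_comp; first by move=> v _; exact: coord_continuous.
by apply: open_closedC; exact: ball_open.
Qed.

(** A point outside the support has a null open neighbourhood, which contains a null rational cube
    around the point. Countability of the cubes then makes the support measurable and its complement
    null. *)
Lemma supp_compl : ~` supp Xi =
  \bigcup_(qk in [set qk : d.-tuple rat * nat | Xi (rat_box qk) = 0]) rat_box qk.
Proof.
apply/seteqP; split=> [x /existsNP[U /not_implyP[oU /not_implyP[Ux]]]|].
  move/negP; rewrite lt0e measure_ge0 andbT negbK => /eqP U0.
  move: Ux; rewrite [in X in X -> _](open_bigcup_rat_box oU) => -[qk /= qkU qkx].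
  exists qk => //=; apply/eqP; rewrite -measure_le0 -U0; apply: le_measure => //.
  - by rewrite inE; exact: measurable_rat_box.
  - by rewrite inE; exact: measurable_mx_open.
move=> x [qk /= qk0 qkx] /(_ _ (@open_rat_box qk) qkx).
by rewrite qk0 ltxx.
Qed.

Lemma measurable_supp : measurable (supp Xi).
Proof.
rewrite -(setCK (supp Xi)) supp_compl; apply: measurableC; rewrite bigcup_mkcond.
apply: countable_bigcupT_measurable => // qk; case: ifP => // _.
exact: measurable_rat_box.
Qed.

Lemma measure_supp_compl : Xi (~` supp Xi) = 0.
Proof.
rewrite supp_compl bigcup_mkcond; apply: measure_bigcup_null => qk.
  by case: ifP => // _; exact: measurable_rat_box.
by case: ifPn => [|_]; rewrite ?inE// measure0.
Qed.

Hypothesis simple_Xi : simple_configuration Xi.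

(** Balls around a support point have positive, hence at least unit, integer mass. Continuity from
    above passes this bound to the point itself, so simplicity leaves only the value 1. *)
Lemma supp_atom x : supp Xi x -> Xi [set x] = 1.
Proof.
move=> sx; case: (simple_Xi x) => // x0; exfalso.
pose B k := ball x k.+1%:R^-1.
have mB k : measurable (B k) by apply: measurable_mx_open; exact: ball_open.
have capB : \bigcap_k B k = [set x].
  apply/seteqP; split=> [y yB|_ -> k _]; last by apply: ballxx; rewrite invr_gt0.
  apply/eqP; rewrite -subr_eq0 -normr_le0 leNgt; apply/negP => yx.
  have := yB (Num.truncn (`|y - x|^-1)%R) I; rewrite /B -ball_normE/= distrC.
  by apply/negP; rewrite -leNgt ltW// invf_plt ?posrE// truncnS_gt.
(* Continuity from above needs one ball of finite mass. *)
have B0oo : Xi (B 0%N) < +oo.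
  apply: configuration_bounded => //; exists (`|x| + 1)%R; split; first exact: num_real.
  move=> M xM y; rewrite /B -ball_normE/= invr1 => xy; apply: ltW; apply: le_lt_trans xM.
  rewrite -lerBlDl (le_trans (lerB_dist _ _))// distrC; exact: ltW.
have : Xi \o B @ \oo --> Xi (\bigcap_k B k).
  apply: nonincreasing_cvg_mu => //.
  - by rewrite capB; exact: measurable_mx_set1.
  - move=> m n mn; apply/subsetPset; apply: le_ball.
    by rewrite lef_pV2 ?posrE// ler_nat.
rewrite capB x0 => B0.
have : 1 <= limn (Xi \o B).
  apply: lime_ge; first by apply/cvg_ex; exists 0.
  apply: nearW => k /=; rewrite leNgt; apply/negP => /(configuration_lt1 (mB k)) Bk0.
  have : 0 < Xi (B k) by apply: sx; [exact: ball_open|exact: ballxx].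
  by rewrite Bk0 ltxx.
by rewrite (cvg_lim _ B0)// lee_fin ler10.
Qed.

Lemma finite_supp_card (S : set V) : finite_set S -> S `<=` supp Xi ->
  Xi S = \esum_(x in S) 1.
Proof.
move=> fS Ssupp; rewrite esum_fset// -[in LHS](fsbig_setU_set1 fS) measure_fsbig//.
- by apply: eq_fsbigr => x /set_mem/Ssupp; exact: supp_atom.
- by move=> x _; exact: measurable_mx_set1.
- apply/trivIsetP => x y _ _ /eqP xy; apply/seteqP; split=> // z [/= zx zy].
  by apply: xy; rewrite -zx.
Qed.

Lemma esum_supp (A : set V) : measurable A -> Xi A < +oo ->
  finite_set (supp Xi `&` A) /\ \esum_(x in supp Xi `&` A) 1 = Xi A.
Proof.
move=> mA Aoo.
have XS : Xi (supp Xi `&` A) = Xi A.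
  rewrite -[in RHS](setTI A) -(setUv (supp Xi)) setIUl measureU//.
  - rewrite [X in _ = _ + X](_ : _ = 0) ?adde0//.
    apply/eqP; rewrite -measure_le0 -measure_supp_compl; apply: le_measure.
    + rewrite inE; apply: measurableI => //; apply: measurableC; exact: measurable_supp.
    + rewrite inE; apply: measurableC; exact: measurable_supp.
    + exact: subIsetl.
  - by apply: measurableI => //; exact: measurable_supp.
  - by apply: measurableI => //; apply: measurableC; exact: measurable_supp.
  - by rewrite setIACA setICr set0I.
have fS : finite_set (supp Xi `&` A).
  (* Infinitely many support points in [A] would include a finite set of more than [Xi A] atoms,
     whose mass exceeds that of [A]. *)
  apply: contrapT => /(infinite_set_fset (Num.truncn (fine (Xi A))).+1)[B BS cB].
  set C : set V := (X in X `<=` _) in BS.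
  have fC : finite_set C by exact: finite_fset.
  have : Xi C <= Xi A.
    rewrite le_measure ?inE//.
    + apply: measurable_mx_closed; apply: compact_closed; first exact: norm_hausdorff.
      exact: finite_compact.
    + by move=> x /BS[].
  rewrite (finite_supp_card fC); last by move=> x /BS[].
  rewrite finite_card_sum// set_fsetK -(@fineK _ (Xi A)) ?ge0_fin_numE// lee_fin.
  apply/negP; rewrite -ltNge; apply: lt_le_trans (truncnS_gt _) _.
  by rewrite ler_nat.
by split=> //; rewrite -XS finite_supp_card//; exact: subIsetl.
Qed.

Lemma esum_supp_indic (A : set V) : measurable A -> Xi A < +oo ->
  \esum_(x in supp Xi) (\1_A x)%:E = Xi A.
Proof.
move=> mA Aoo; have [_ <-] := esum_supp mA Aoo.
rewrite esum_mkcondr; apply: eq_esum => x _.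
by rewrite indicE; case: ifP.
Qed.

Lemma distinct_sum1 (A : set V) : measurable A -> Xi A < +oo ->
  distinct_sum (fun t : 1.-tuple V => \1_A (thead t)) Xi = Xi A.
Proof.
move=> mA Aoo; rewrite /distinct_sum -[RHS]esum_supp_indic//.
rewrite (reindex_esum (supp Xi) _ (fun x => [tuple x]))//; split => /=.
- by move=> x sx /=; split=> // i; rewrite ord1.
- by move=> x y _ _ /(congr1 (@thead _ _)); rewrite !theadE.
- by move=> t [_ st]; exists (thead t); [exact: st|apply: eq_from_tnth => i; rewrite ord1].
Qed.

(** Once the first point [x] in [A] is fixed, the second ranges over the support points in [A] other
    than [x]. There are [Xi A - 1] of them because the atom at [x] has mass one, and there are
    [Xi A] choices of [x]. *)
Lemma distinct_sum2 (A : set V) : measurable A -> Xi A < +oo ->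
  distinct_sum (fun t : 2.-tuple V => \1_A (tnth t ord0) * \1_A (tnth t ord_max))%R Xi =
  Xi A * (Xi A - 1).
Proof.
move=> mA Aoo; rewrite /distinct_sum.
rewrite (reindex_esum (supp Xi `*`` (fun x => supp Xi `\ x)) _
  (fun p => [tuple p.1; p.2]))//=; last first.
  split => /=.
  - move=> [x y] [/= sx [sy yx]]; split.
      by rewrite inE andbT; apply/eqP => xy; apply: yx.
    by move=> i; case: (unliftP ord0 i) => [j|] ->; rewrite ?tnthS// ord1.
  - by move=> [x y] [x' y'] _ _ [-> ->].
  - move=> t [ut st]; exists (tnth t ord0, tnth t ord_max) => /=.
    + split=> //=; split=> // /= e. by have /tuple_uniqP/(_ _ _ e) := ut.
    + by apply: eq_from_tnth => -[[|[|//]] i]; rewrite /tnth/=; apply: set_nth_default; rewrite size_tuple.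
rewrite -(esum_esum (a := fun x y => (\1_A x * \1_A y)%:E)); last first.
  by move=> x y _ _; rewrite lee_fin mulr_ge0.
have [fS S1] := esum_supp mA Aoo.
transitivity (\esum_(x in supp Xi `&` A) (Xi A - 1)).
  rewrite esum_mkcondr; apply: eq_esum => x sx.
  case: ifPn => [/set_mem Ax|Ax]; last first.
    by rewrite esum1// => y _; rewrite indicE (negbTE Ax) mul0r.
    have mAx : measurable (A `\ x) by apply: measurableD => //; exact: measurable_mx_set1.
    have XAx : Xi (A `\ x) = Xi A - 1.
      rewrite measureD//; last exact: measurable_mx_set1.
      by rewrite [in X in _ - X](setIidr (_ : [set x] `<=` A)); [congr (_ - _); exact: supp_atom|move=> y ->].
    rewrite -XAx -[RHS](esum_supp mAx _).2; last first.
      by apply: le_lt_trans Aoo; rewrite le_measure ?inE//; exact: subDsetl.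
    rewrite setDE setIA setIAC -setDE [RHS]esum_mkcondr; apply: eq_esum => y _.
    by rewrite !indicE mem_set// mul1r; case: (y \in A).
rewrite esum_fset//; last first.
  move=> x /set_mem[sx Ax]; rewrite sube_ge0//; rewrite -(supp_atom sx).
  rewrite le_measure ?inE//; first exact: measurable_mx_set1.
  by move=> y ->.
rewrite (eq_fsbigr (fun=> (Xi A - 1) * 1)); last by move=> x _; rewrite mule1.
by rewrite -ge0_mule_fsumr// -esum_fset// S1 muleC.
Qed.

End configuration.

(** * Integrals of nonnegative functions that may fail to be measurable *)

Section integral_ae.
Import HBNNSimple.
Context d (T : measurableType d) (R : realType).
Variable mu : {measure set T -> \bar R}.
Local Open Scope ereal_scope.

(** The integral of a nonnegative function is the supremum over the simple functions below it, so
    enlarging the function enlarges the family. *)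
Lemma ge0_integral_mono (f g : T -> \bar R) :
  (forall x, 0 <= f x) -> (forall x, f x <= g x) ->
  \int[mu]_x f x <= \int[mu]_x g x.
Proof.
move=> f0 fg; rewrite !ge0_integralTE//; last by move=> x; exact: le_trans (fg x).
apply: le_ereal_sup => _ [h hf <-]; exists h => // x.
exact: le_trans (hf x) (fg x).
Qed.

(* [f] need not be measurable: this is applied to [distinct_sum], whose
   measurability is not known. *)
Lemma ge0_integral_ae_measurable (f g : T -> \bar R) :
  measurable_fun [set: T] g -> (forall x, 0 <= f x) -> (forall x, 0 <= g x) ->
  {ae mu, forall x, f x = g x} -> \int[mu]_x f x = \int[mu]_x g x.
Proof.
move=> mg f0 g0 fg; apply/eqP; rewrite eq_le; apply/andP; split.
  (* A simple function below [f] is below [g] almost everywhere, and both of these are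
     measurable. *)
  rewrite ge0_integralTE//; apply: ge_ereal_sup => _ [h hf <-].
  rewrite -integralT_nnsfun; apply: ae_ge0_le_integral => //.
  - by move=> x _; rewrite lee_fin; exact: fun_ge0.
  - exact/measurable_EFinP/measurable_funP.
  - by apply: filterS fg => x <- _; exact: hf.
case: fg => N [mN N0 fgN].
(* Conversely, cutting [g] to zero on the measurable null set [N] keeps its integral and puts it
   below [f] everywhere. *)
have E x : ((\1_(~` N) x)%:E * g x) <= f x.
  rewrite indicE; case: (boolP (x \in ~` N)) => [xN|_]; last by rewrite mul0e.
  rewrite mul1e; have [->//|fgx] := pselect (f x = g x).
  by have := set_mem xN; have := fgN _ fgx.
apply: le_trans (ge0_integral_mono _ E); last by move=> x; rewrite mule_ge0// lee_fin.
rewrite (@ge0_ae_eq_integral _ _ _ _ _ g (fun x => (\1_(~` N) x)%:E * g x))//.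
- apply: emeasurable_funM => //; apply/measurable_EFinP; apply: measurable_indic.
  exact: measurableC.
- by move=> x _; rewrite mule_ge0// lee_fin.
- exists N; split=> // x; apply: contra_notP => /= xN _.
  by rewrite indicE mem_set// mul1e.
Qed.

End integral_ae.

(** * Null sets and iterated integrals for power measures *)

Section power_measure_ae.
Context d (T : measurableType d) (R : realType).
Variable mu : {sigma_finite_measure set T -> \bar R}.
Local Open Scope ereal_scope.

Lemma power_measure_null n (N : set T) (i : 'I_n) : measurable N -> mu N = 0 ->
  power_measure mu n [set t : n.-tuple T | N (tnth t i)] = 0.
Proof.
move=> mN N0; elim: n i => [[]//|n IH] i.
have mNi (j : 'I_n) : measurable [set t : n.-tuple T | N (tnth t j)].
  by rewrite -[X in measurable X]setTI; exact: measurable_tnth.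
case: (unliftP ord0 i) => [j|] ->.
  rewrite (_ : [set t | _] = [set t : n.+1.-tuple T | setT (thead t) /\
    [set t : n.-tuple T | N (tnth t j)] [tuple of behead t]]).
    (* The factor [mu setT] may be [+oo]; in [\bar R] its product with 0 is 0. *)
    transitivity (mu setT * power_measure mu n [set t : n.-tuple T | N (tnth t j)]).
      exact: cons_measureX.
    by rewrite IH mule0.
  have tB (t : n.+1.-tuple T) : tnth t (lift ord0 j) = tnth [tuple of behead t] j.
    by rewrite [in LHS](tuple_eta t) tnthS.
  by apply/seteqP; split=> t /=; rewrite tB// => -[].
rewrite (_ : [set t | _] = [set t : n.+1.-tuple T | N (thead t) /\
    setT [tuple of behead t]]).
  transitivity (mu N * power_measure mu n [set: n.-tuple T]).
    exact: cons_measureX.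
  by rewrite N0 mul0e.
by apply/seteqP; split=> t /=; [|move=> []].
Qed.

Lemma power_measure_ae n (P : T -> Prop) (i : 'I_n) :
  {ae mu, forall x, P x} -> {ae power_measure mu n, forall t, P (tnth t i)}.
Proof.
move=> [N [mN N0 PN]]; exists [set t : n.-tuple T | N (tnth t i)]; split.
- by rewrite -[X in measurable X]setTI; exact: measurable_tnth.
- exact: power_measure_null.
- by move=> t; exact: PN.
Qed.

Lemma measurable_cons_cst n (x : T) :
  measurable_fun [set: n.-tuple T] (fun t : n.-tuple T => [tuple of x :: t]).
Proof.
apply/measurable_fun_tnthP => i; case: (unliftP ord0 i) => [j|] ->.
  rewrite (_ : _ \o _ = @tnth n T ^~ j); first exact: measurable_tnth.
  by apply/funext => t /=; rewrite tnthS.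
by rewrite (_ : _ \o _ = cst x).
Qed.

Lemma ge0_integral_power_measure1 (f : 1.-tuple T -> \bar R) :
  measurable_fun [set: 1.-tuple T] f -> (forall t, 0 <= f t) ->
  \int[power_measure mu 1]_t f t = \int[mu]_x f [tuple x].
Proof.
move=> mf f0; rewrite [LHS]ge0_integral_cons_measure//.
apply: eq_integral => x _ /=; rewrite integral_dirac//.
  by rewrite diracT mul1e; congr f; exact: val_inj.
by apply: (measurableT_comp mf); exact: measurable_cons_cst.
Qed.

Lemma ge0_integral_power_measure2 (f : 2.-tuple T -> \bar R) :
  measurable_fun [set: 2.-tuple T] f -> (forall t, 0 <= f t) ->
  \int[power_measure mu 2]_t f t = \int[mu]_x \int[mu]_y f [tuple x; y].
Proof.
move=> mf f0; rewrite [LHS]ge0_integral_cons_measure//.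
apply: eq_integral => x _ /=.
rewrite [LHS]ge0_integral_power_measure1//.
by apply: (measurableT_comp mf); exact: measurable_cons_cst.
Qed.

(** The measures of the sections of a null set integrate to 0, so almost all of them vanish. *)
Lemma ae_xsection d' (T' : measurableType d') (nu : {sigma_finite_measure set T' -> \bar R})
    (P : T * T' -> Prop) : {ae (mu \x nu), forall p, P p} ->
  {ae mu, forall x, {ae nu, forall y, P (x, y)}}.
Proof.
move=> [N [mN N0 PN]].
have : {ae mu, forall x, (nu \o xsection N) x = 0}.
  have E : \int[mu]_x `|(nu \o xsection N) x| = 0.
    by rewrite -[RHS]N0; apply: eq_integral => x _; rewrite gee0_abs.
  have := (ae_eq_integral_abs mu measurableT (measurable_fun_xsection nu mN)).1 E.
  by apply: filterS => x /(_ I).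
apply: filterS => x Nx; exists (xsection N x); split => //.
  exact: measurable_xsection.
by move=> y Py; rewrite /xsection /= inE; exact: PN.
Qed.

End power_measure_ae.

(** * Variance from factorial moments, squared moduli and a two by two determinant *)

Lemma variance_factorial d (T : measurableType d) (R : realType)
    (P : probability T R) (X : T -> R) (m q : R) :
  measurable_fun [set: T] X -> (forall w, 0 <= X w) ->
  (forall w, 0 <= X w * (X w - 1)) ->
  (\int[P]_w (X w)%:E = m%:E)%E ->
  (\int[P]_w (X w * (X w - 1))%:E = q%:E)%E ->
  ('V_P[X] = (q + m - m ^+ 2)%:E)%E.
Proof.
move=> mX X0 XX0 Em Eq.
have m0 : 0 <= m by rewrite -lee_fin -Em integral_ge0// => w _; rewrite lee_fin.
rewrite /variance covariance.unlock !expectation.unlock Em/=.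
set V := (X in X = _).
have mX1 : measurable_fun [set: T] (fun w => (X w * (X w - 1))%:E).
  apply/measurable_EFinP; apply: measurable_funM => //.
  by apply: measurable_funB.
have mXm : measurable_fun [set: T] (fun w => (X w - m) * (X w - m)).
  by apply: measurable_funM; apply: measurable_funB.
(* [(X - m)^2 + 2 m X = X (X - 1) + X + m^2] has only nonnegative terms. *)
have V2 : (V + (2 * m)%:E * m%:E = q%:E + m%:E + (m ^+ 2)%:E)%E.
  rewrite -[in LHS]Em -Eq -[in RHS]Em -ge0_integralZl//; last 3 first.
  - exact/measurable_EFinP.
  - by move=> w _; rewrite lee_fin.
  - by rewrite lee_fin mulr_ge0.
  rewrite /V -ge0_integralD//; last 4 first.
  - by move=> w _; rewrite lee_fin -expr2 sqr_ge0.
  - exact/measurable_EFinP.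
  - by move=> w _; rewrite -EFinM lee_fin !mulr_ge0.
  - by apply: emeasurable_funM => //; exact/measurable_EFinP.
  rewrite -ge0_integralD//; last 3 first.
  - by move=> w _; rewrite lee_fin.
  - by move=> w _; rewrite lee_fin.
  - exact/measurable_EFinP.
  have -> : ((m ^+ 2)%:E = \int[P]_w (cst (m ^+ 2)%:E) w)%E.
    by rewrite integral_cst//= probability_setT mule1.
  rewrite -ge0_integralD//; last 3 first.
  - by move=> w _; rewrite -EFinD lee_fin addr_ge0.
  - by apply: emeasurable_funD => //; exact/measurable_EFinP.
  - by move=> w _; rewrite lee_fin sqr_ge0.
  apply: eq_integral => w _; rewrite -!EFinM -!EFinD; congr EFin.
  by transitivity ((X w - m) * (X w - m) + 2 * m * X w)%R; [by []|rewrite /cst/=; ring].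
(* Finiteness of the variance is read off the identity: it is a summand of a finite sum. *)
have Vfin : V \is a fin_num.
  have : (V + (2 * m)%:E * m%:E)%E \is a fin_num by rewrite V2.
  by rewrite fin_numD => /andP[].
move: V2; rewrite -(fineK Vfin) -!EFinM -!EFinD => -[V2]; congr EFin.
move: V2; set v := fine V; lra.
Qed.

Lemma normc_sqE (R : rcfType) (z : R[i]) :
  Normc.normc z ^+ 2 = complex.Re z ^+ 2 + complex.Im z ^+ 2.
Proof. by case: z => a b /=; rewrite sqr_sqrtr// addr_ge0// sqr_ge0. Qed.

Lemma mulc_conjc (R : rcfType) (z : R[i]) :
  z * conjc z = real_complex R (Normc.normc z ^+ 2).
Proof.
rewrite normc_sqE; case: z => a b; apply/eqP; rewrite eq_complex /=.
by apply/andP; split; apply/eqP; ring.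
Qed.

Lemma measurable_normc_sq d (T : measurableType d) (R : realType) (f : T -> R[i]) :
  cmeasurable f -> measurable_fun [set: T] (fun x => Normc.normc (f x) ^+ 2).
Proof.
move=> [mRe mIm]; under eq_fun do rewrite normc_sqE.
by apply: measurable_funD; apply: measurable_funX.
Qed.

Lemma det_mx22 (R : comNzRingType) (M : 'M[R]_2) :
  \det M = M ord0 ord0 * M ord_max ord_max - M ord0 ord_max * M ord_max ord0.
Proof.
have l0 : lift ord0 (ord0 : 'I_1) = ord_max by exact: val_inj.
have l1 : lift ord_max (ord0 : 'I_1) = ord0 by exact: val_inj.
rewrite (expand_det_row _ ord0) big_ord_recl big_ord1 /cofactor !det_mx11 !mxE.
rewrite !l0 l1 /=.
by rewrite addn0 expr0 expr1 mulN1r mul1r mulrN.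
Qed.

(** * The squared modulus of the projection kernel *)

Section kernel.
Context (R : realType) (d : nat).
Local Notation V := 'rV[R]_d.
Local Notation leb := (@lebesgue_rV R d).
Variables (calK : (V -> R[i]) -> (V -> R[i])) (K : V -> V -> R[i]).
Hypothesis projK : projection_kernel calK K.
Hypothesis K1 : \forall x \ae leb, K x x = 1.

Let k x y : R := Normc.normc (K x y) ^+ 2.

Let k_ge0 x y : 0 <= k x y. Proof. exact: sqr_ge0. Qed.

Lemma measurable_kernel_sq : measurable_fun [set: V * V] (fun p => k p.1 p.2).
Proof. by apply: (measurable_normc_sq (f := fun p => K p.1 p.2)); have [[]] := projK. Qed.

Lemma integral_kernel_sq :
  {ae leb, forall x, (\int[leb]_y (k x y)%:E = 1)%E}.
Proof.
have [_ [D [mD D0 KD intD]]] := projK.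
have aeD : {ae leb, forall x, D x} by exists (~` D); split=> //; exact: measurableC.
apply: filterS2 (aeD) (K1) => x Dx Kxx.
have [[iRe _] /(congr1 (@complex.Re R)) /=] := intD x x Dx Dx.
rewrite Kxx /= => int1.
have -> : (\int[leb]_y (k x y)%:E = \int[leb]_y (complex.Re (K x y * K y x))%:E)%E.
  apply: ae_eq_integral => //.
  - apply/measurable_EFinP.
    exact: (measurableT_comp measurable_kernel_sq (pair1_measurable x)).
  - exact: measurable_int iRe.
  - apply: filterS (aeD) => y Dy _; congr EFin.
    by rewrite (KD y x)// mulc_conjc.
(* [cintegral] uses the real-valued integral, that is [fine] of the extended one; integrability
   makes the two agree. *)
by rewrite -(fineK (integrable_fin_num _ iRe))//; congr EFin; exact: int1.
Qed.

Lemma det_kernel2 : {ae power_measure leb 2, forall t,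
  \det (\matrix_(i, j) K (tnth t i) (tnth t j)) =
  real_complex R (1 - k (tnth t ord0) (tnth t ord_max))}.
Proof.
have [_ [D [mD D0 KD _]]] := projK.
have aeD : {ae leb, forall x, D x} by exists (~` D); split=> //; exact: measurableC.
have D1 := power_measure_ae (n := 2) ord0 aeD.
have D2 := power_measure_ae (n := 2) ord_max aeD.
have E1 := power_measure_ae (n := 2) ord0 K1.
have E2 := power_measure_ae (n := 2) ord_max K1.
apply: filterS2 (filterI D1 E1) (filterI D2 E2) => t [Dx Kx] [Dy Ky].
by rewrite det_mx22 !mxE Kx Ky mulr1 (KD _ _ Dy Dx) mulc_conjc rmorphB rmorph1.
Qed.

End kernel.

(** * Mean and variance of the number of points in a bounded set *)

Section moments.
Context (R : realType) (d : nat).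
Local Notation V := 'rV[R]_d.
Local Notation leb := (@lebesgue_rV R d).
Variables (calK : (V -> R[i]) -> (V -> R[i])) (K : V -> V -> R[i]).
Variable P : probability (configuration R d) R.
Hypothesis projK : projection_kernel calK K.
Hypothesis K1 : \forall x \ae leb, K x x = 1.
Hypothesis detP : determinantal P K.
Variable A : set V.
Hypothesis mA : measurable A.
Hypothesis bA : bounded_set A.

Let k x y : R := Normc.normc (K x y) ^+ 2.
Let k_ge0 x y : 0 <= k x y. Proof. exact: sqr_ge0. Qed.
Let mk : measurable_fun [set: V * V] (fun p => k p.1 p.2).
Proof. exact: measurable_kernel_sq projK. Qed.

Lemma measurable_evaluation (B : set V) : measurable B ->
  measurable_fun [set: configuration R d] (fun Xi : configuration R d => Xi B).
Proof.
move=> mB _ Y mY; apply: sub_sigma_algebra; exists B => //.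
by exists Y.
Qed.

Lemma measurable_npoints (B : set V) : measurable B ->
  measurable_fun [set: configuration R d] (@npoints R d B).
Proof.
move=> mB; apply: measurableT_comp; first exact: fine_measurable.
exact: measurable_evaluation.
Qed.

Lemma npoints_nat (B : set V) (Xi : configuration R d) : measurable B ->
  exists n : nat, npoints B Xi = n%:R.
Proof.
move=> mB; rewrite /npoints; case: (configuration_nat Xi mB) => [->|[n ->]].
  by exists 0%N.
by exists n.
Qed.

Lemma npointsE (Xi : configuration R d) : (npoints A Xi)%:E = Xi A.
Proof. by rewrite /npoints fineK// ge0_fin_numE// configuration_bounded. Qed.

Lemma compactly_supported_prod n (f : n.-tuple V -> R) :
  (forall t, (exists i, ~ A (tnth t i)) -> f t = 0) -> compactly_supported f.
Proof.
move=> f0; have [C cC AC] := bounded_compact_hull bA.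
by exists C => // t [i tC]; apply: f0; exists i => /AC.
Qed.

Lemma integral_npoints : (\int[P]_Xi (npoints A Xi)%:E = leb A)%E.
Proof.
have [simpleP /(_ 1%N isT)[rho [[mrho rho0 corr] rhoE]]] := detP.
pose f : 1.-tuple V -> R := fun t => \1_A (thead t).
have mf : measurable_fun [set: 1.-tuple V] f.
  apply: (measurableT_comp (f := (\1_A : V -> R))); first exact: measurable_indic.
  exact: measurable_tnth.
have f0 t : 0 <= f t by [].
have cf : compactly_supported f.
  apply: compactly_supported_prod => t [j].
  by rewrite ord1 => tA; rewrite /f indicE memNset.
rewrite -(ge0_integral_ae_measurable (f := distinct_sum f)); last 4 first.
- by apply/measurable_EFinP; exact: measurable_npoints.
- by move=> Xi; apply: esum_ge0 => t _; rewrite lee_fin.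
- by move=> Xi; rewrite npointsE.
- apply: filterS simpleP => Xi sXi; rewrite npointsE; apply: distinct_sum1 => //.
  exact: configuration_bounded.
rewrite corr//.
rewrite (@ge0_ae_eq_integral _ _ _ _ _ _ (EFin \o f))//; last 5 first.
- by apply/measurable_EFinP; apply: measurable_funM.
- exact/measurable_EFinP.
- by move=> t _; rewrite lee_fin mulr_ge0.
- by move=> t _; rewrite lee_fin.
- have K11 := power_measure_ae (n := 1) ord0 K1.
  apply: filterS2 K11 rhoE => t Kt + _ /=.
  rewrite det_mx11 mxE Kt => /(congr1 (@complex.Re R))/= ->.
  by rewrite mulr1.
rewrite ge0_integral_power_measure1//; last exact/measurable_EFinP.
by rewrite /f /= /thead/= integral_indic// setIT.
Qed.

(** Used with [B] equal to [A] for the pair correlation, and to its complement for the variance. *)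
Let wk B x y : R := \1_A x * \1_B y * k x y.

Let wk_ge0 B x y : 0 <= wk B x y.
Proof. by rewrite /wk mulr_ge0// mulr_ge0. Qed.

Let mwk B : measurable B -> measurable_fun [set: V * V] (fun p => (wk B p.1 p.2)%:E).
Proof.
move=> mB; apply/measurable_EFinP; apply: measurable_funM => //; apply: measurable_funM.
- apply: (measurableT_comp (f := (\1_A : V -> R))); first exact: measurable_indic.
  exact: measurable_fst.
- apply: (measurableT_comp (f := (\1_B : V -> R))); first exact: measurable_indic.
  exact: measurable_snd.
Qed.

Lemma integral_npoints_pairs :
  (\int[P]_Xi (npoints A Xi * (npoints A Xi - 1))%:E +
   \int[leb]_x \int[leb]_y (wk A x y)%:E = leb A * leb A)%E.
Proof.
have [simpleP /(_ 2%N isT)[rho [[mrho rho0 corr] rhoE]]] := detP.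
pose f : 2.-tuple V -> R := fun t => \1_A (tnth t ord0) * \1_A (tnth t ord_max).
have mf : measurable_fun [set: 2.-tuple V] f.
  apply: measurable_funM; apply: (measurableT_comp (f := (\1_A : V -> R)));
    by [exact: measurable_indic|exact: measurable_tnth].
have f0 t : 0 <= f t by rewrite mulr_ge0.
have cf : compactly_supported f.
  apply: compactly_supported_prod => t [j]; rewrite /f !indicE.
  case: (unliftP ord0 j) => [l|] -> tA; last by rewrite memNset ?mul0r.
  rewrite [X in _ * X](_ : _ = 0) ?mulr0// memNset//.
  by rewrite (_ : ord_max = lift ord0 l)//; rewrite ord1; exact: val_inj.
rewrite -(ge0_integral_ae_measurable (f := distinct_sum f)); last 4 first.
- apply/measurable_EFinP; apply: measurable_funM; first exact: measurable_npoints.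
  by apply: measurable_funB => //; exact: measurable_npoints.
- by move=> Xi; apply: esum_ge0 => t _; rewrite lee_fin.
(* [x * (x - 1)] is negative between 0 and 1, so the sign comes from integer values. *)
- move=> Xi; have [[|n] ->] := npoints_nat Xi mA; rewrite lee_fin; first by rewrite mul0r.
  by rewrite mulr_ge0// subr_ge0 ler1n.
- apply: filterS simpleP => Xi sXi; rewrite EFinM EFinB npointsE.
  by apply: distinct_sum2 => //; exact: configuration_bounded.
rewrite corr//.
pose kt (t : 2.-tuple V) := f t * k (tnth t ord0) (tnth t ord_max).
have mkt : measurable_fun [set: 2.-tuple V] kt.
  apply: measurable_funM => //.
  apply: (measurableT_comp mk (g := fun t : 2.-tuple V => (tnth t ord0, tnth t ord_max))).
  by apply: measurable_fun_pair; exact: measurable_tnth.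
have -> : (\int[leb]_x \int[leb]_y (wk A x y)%:E = \int[power_measure leb 2]_t (kt t)%:E)%E.
  rewrite ge0_integral_power_measure2//.
  - exact/measurable_EFinP.
  - by move=> t; rewrite lee_fin mulr_ge0.
rewrite -ge0_integralD//; last 4 first.
- by move=> t _; rewrite lee_fin mulr_ge0.
- by apply/measurable_EFinP; apply: measurable_funM.
- by move=> t _; rewrite lee_fin mulr_ge0.
- exact/measurable_EFinP.
rewrite (@ge0_ae_eq_integral _ _ _ _ _ _ (EFin \o f))//; last 5 first.
- apply: emeasurable_funD; apply/measurable_EFinP => //.
  by apply: measurable_funM.
- exact/measurable_EFinP.
- by move=> t _; rewrite -EFinD lee_fin addr_ge0// mulr_ge0.
- by move=> t _; rewrite lee_fin.
- apply: filterS2 (det_kernel2 projK K1) rhoE => t -> /(congr1 (@complex.Re R))/= -> _ /=.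
  by rewrite -EFinD; congr EFin; rewrite /kt /k; ring.
rewrite ge0_integral_power_measure2//; last exact/measurable_EFinP.
have IA : (\int[leb]_x (\1_A x)%:E = leb A)%E by rewrite integral_indic// setIT.
rewrite (eq_integral (fun x => (\1_A x)%:E * leb A)%E).
  by rewrite ge0_integralZr ?IA//; apply/measurable_EFinP; exact: measurable_indic.
move=> x _; transitivity (\int[leb]_y ((\1_A x)%:E * (\1_A y)%:E))%E; first by [].
by rewrite ge0_integralZl ?IA//; apply/measurable_EFinP; exact: measurable_indic.
Qed.

(** For fixed [x], the set [A] and its complement split the integral of [k x] over the whole space,
    which is 1 for almost every [x]. *)
Lemma integral_kernel_split :
  (\int[leb]_x \int[leb]_y (wk A x y)%:E + \int[leb]_x \int[leb]_y (wk (~` A) x y)%:E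
   = leb A)%E.
Proof.
have mcA : measurable (~` A) by exact: measurableC.
have FT B : measurable B -> (\int[leb]_x \int[leb]_y (wk B x y)%:E =
    \int[leb \x leb]_p (wk B p.1 p.2)%:E)%E.
  by move=> mB; rewrite fubini_tonelli1//; [exact: mwk|move=> p; rewrite lee_fin].
have mAk : measurable_fun [set: V * V] (fun p => (\1_A p.1 * k p.1 p.2)%:E).
  apply/measurable_EFinP; apply: measurable_funM => //.
  apply: (measurableT_comp (f := (\1_A : V -> R))); first exact: measurable_indic.
  exact: measurable_fst.
have Ak0 p : (0 <= (\1_A p.1 * k p.1 p.2)%:E)%E by rewrite lee_fin mulr_ge0.
rewrite !FT// -ge0_integralD//; last 4 first.
- by move=> p _; rewrite lee_fin.
- exact: mwk.
- by move=> p _; rewrite lee_fin.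
- exact: mwk.
rewrite (eq_integral (fun p => (\1_A p.1 * k p.1 p.2)%:E)); last first.
  move=> p _; rewrite -EFinD; congr EFin; rewrite /wk -mulrDl -mulrDr; congr (_ * _).
  by rewrite [X in _ * X](_ : _ = 1) ?mulr1// !indicE in_setC; case: (_ \in _); rewrite ?addr0 ?add0r.
rewrite fubini_tonelli1//.
transitivity (\int[leb]_x (\1_A x)%:E)%E; last by rewrite integral_indic// setIT.
apply: ge0_ae_eq_integral => //.
- exact: measurable_fun_fubini_tonelli_F.
- by apply/measurable_EFinP; exact: measurable_indic.
- by move=> x _; apply: integral_ge0 => y _; exact: (Ak0 (x, y)).
- apply: filterS (integral_kernel_sq projK K1) => x kx _.
  transitivity ((\1_A x)%:E * \int[leb]_y (k x y)%:E)%E; last by rewrite kx mule1.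
  rewrite -ge0_integralZl//.
    apply/measurable_EFinP; exact: (measurableT_comp mk (pair1_measurable x)).
  by move=> y _; rewrite lee_fin.
Qed.

(** With [a] the measure of [A], the two identities read [S + J = a * a] and [J + W = a]. Hence the
    variance [S + a - a ^+ 2] is [a - J = W], and all terms are finite because [a] is. *)
Lemma variance_npoints :
  ('V_P[npoints A] = \int[leb]_x \int[leb]_y (wk (~` A) x y)%:E)%E.
Proof.
have := integral_kernel_split; have := integral_npoints_pairs; have := integral_npoints.
have : leb A \is a fin_num by rewrite ge0_fin_numE//; exact: lebesgue_rV_bounded.
move: (leb A) => a; move: (a) => [{}a| |]// _.
set W := (X in _ -> _ -> _ -> _ = X).
set J := (\int[_]_x \int[_]_y (wk A x y)%:E)%E.
set S := (X in _ -> (X + _ = _)%E -> _) => Ea ES EJ.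
have : (S + J)%E \is a fin_num by rewrite ES.
rewrite fin_numD => /andP[Sfin Jfin].
have : (J + W)%E \is a fin_num by rewrite EJ.
rewrite fin_numD => /andP[_ Wfin].
rewrite (variance_factorial (m := a) (q := fine S))//.
- rewrite -[RHS](fineK Wfin); congr EFin.
  have ES' : fine S + fine J = a * a by apply: EFin_inj; rewrite EFinD EFinM !fineK.
  have EJ' : fine J + fine W = a by apply: EFin_inj; rewrite EFinD !fineK.
  by lra.
- exact: measurable_npoints.
- by move=> Xi; rewrite -lee_fin npointsE.
- move=> Xi; have [[|n] ->] := npoints_nat Xi mA; first by rewrite mul0r.
  by rewrite mulr_ge0// subr_ge0 ler1n.
- by rewrite fineK.
Qed.

End moments.

(** * A translation-invariant density for the squared kernel *)

Section radial_density.
Context (R : realType) (d : nat).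
Local Notation V := 'rV[R]_d.
Local Notation leb := (@lebesgue_rV R d).

Lemma ae_shift (Q : V -> Prop) (a : V) :
  {ae leb, forall y, Q y} -> {ae leb, forall y, Q (y + a)}.
Proof.
move=> [N [mN N0 QN]]; exists ((fun y => 1 *: y + a) @^-1` N); split.
- by rewrite -[X in measurable X]setTI; exact: measurable_affine.
- by rewrite lebesgue_rV_affine// N0 mule0.
- by move=> y Qy /=; apply: QN; rewrite scale1r.
Qed.

Lemma ge0_integral_shift (f : V -> \bar R) (a : V) :
  measurable_fun [set: V] f -> (forall x, (0 <= f x)%E) ->
  (\int[leb]_x f (x + a)%R = \int[leb]_x f x)%E.
Proof.
move=> mf f0; have := ge0_integral_rV_affine a ltr01 mf f0.
rewrite invr1 expr1n mul1e => <-.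
by apply: eq_integral => x _; rewrite scale1r.
Qed.

Lemma ae_exists (Q : V -> Prop) : (0 < leb [set: V])%E ->
  {ae leb, forall y, Q y} -> exists y, Q y.
Proof.
move=> leb0 [N [mN N0 QN]]; apply: contrapT => nQ.
have NT : N = setT.
  apply/seteqP; split=> // y _; apply: QN => /= Qy; apply: nQ; by exists y.
by move: leb0; rewrite -NT N0 ltxx.
Qed.

Lemma radial_density (calK : (V -> R[i]) -> (V -> R[i])) (K : V -> V -> R[i]) :
  projection_kernel calK K -> (\forall x \ae leb, K x x = 1) -> radial K ->
  (0 < leb [set: V])%E ->
  exists g : V -> R, [/\ measurable_fun [set: V] g, forall z, 0 <= g z,
    (\int[leb]_z (g z)%:E = 1)%E &
    {ae leb, forall x, {ae leb, forall y,
       Normc.normc (K x y) ^+ 2 = g (y - x)}}].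
Proof.
move=> projK K1 [phi [_ Kphi]] leb0.
have aephi := ae_xsection Kphi.
(* One base point serves two purposes: radiality holds from [x0] to almost every point, and the
   squared kernel at [x0] has integral 1. *)
have [x0 [Kx0 int1]] := ae_exists leb0 (filterI aephi (integral_kernel_sq projK K1)).
have mk : measurable_fun [set: V] (fun y => Normc.normc (K x0 y) ^+ 2).
  exact: (measurableT_comp (measurable_kernel_sq projK) (pair1_measurable x0)).
(* [phi] is not known to be measurable, so [g] is read off the kernel at a
   generic point [x0]. *)
exists (fun z => Normc.normc (K x0 (z + x0)) ^+ 2); split.
- apply: (measurableT_comp mk (f := fun y => Normc.normc (K x0 y) ^+ 2)).
  by apply: measurable_fun_addrV => //; exact: measurable_cst.
- by move=> z; exact: sqr_ge0.
- rewrite -int1 (ge0_integral_shift (f := fun y => (Normc.normc (K x0 y) ^+ 2)%:E))//.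
  + exact/measurable_EFinP.
  + by move=> y; rewrite lee_fin sqr_ge0.
- apply: filterS aephi => x Kx.
  (* Radiality at [x0] is evaluated at [y - x + x0], whose displacement from [x0] is that of [y]
     from [x]. Translation keeps the exceptional set null. *)
  apply: filterS2 Kx (ae_shift (x0 - x) Kx0) => y /= -> .
  rewrite [in X in X -> _](_ : y + (x0 - x) = y - x + x0); last by rewrite addrA addrAC.
  move=> ->; congr phi; congr euclidean_norm.
  by rewrite [RHS]addrC opprD subrK opprB.
Qed.

End radial_density.

(** * The rescaled variance and its limit *)

Section boundary_flux.
Context (R : realType) (d : nat).
Local Notation V := 'rV[R]_d.
Local Notation leb := (@lebesgue_rV R d).
Variables (g : V -> R) (Lambda : set V).
Hypothesis mg : measurable_fun [set: V] g.
Hypothesis g0 : forall z, 0 <= g z.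
Hypothesis int_g : (\int[leb]_z (g z)%:E = 1)%E.
Hypothesis oL : open Lambda.
Hypothesis bL : bounded_set Lambda.

Let mL : measurable Lambda. Proof. exact: measurable_mx_open. Qed.
Let Loo : (leb Lambda < +oo)%E. Proof. exact: lebesgue_rV_bounded. Qed.

Let F (c : R) (x z : V) : R := \1_Lambda x * \1_(~` Lambda) (x + c *: z) * g z.

(** As [g] is a probability density, this is the average volume of the part of [Lambda] that leaves
    [Lambda] under a random displacement [c *: z]. *)
Definition boundary_flux (c : R) : \bar R := (\int[leb]_x \int[leb]_z (F c x z)%:E)%E.

Let F0 c x z : 0 <= F c x z.
Proof. by rewrite /F mulr_ge0// mulr_ge0. Qed.

Let mF c : measurable_fun [set: V * V] (fun p => (F c p.1 p.2)%:E).
Proof.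
apply/measurable_EFinP; apply: measurable_funM; last first.
  by apply: (measurableT_comp mg); exact: measurable_snd.
apply: measurable_funM.
- apply: (measurableT_comp (f := (\1_Lambda : V -> R))); first exact: measurable_indic.
  exact: measurable_fst.
- apply: (measurableT_comp (f := (\1_(~` Lambda) : V -> R))).
    by apply: measurable_indic; exact: measurableC.
  apply: measurable_fun_addrV; first exact: measurable_fst.
  by apply: measurable_fun_scalerV; exact: measurable_snd.
Qed.

Let Fg c x z : F c x z <= \1_Lambda x * g z.
Proof.
rewrite /F ler_wpM2r// ler_piMr//.
Qed.

Let int_Lg x : (\int[leb]_z (\1_Lambda x * g z)%:E = (\1_Lambda x)%:E)%E.
Proof.
transitivity (\int[leb]_z ((\1_Lambda x)%:E * (g z)%:E))%E; first by [].
rewrite ge0_integralZl// ?int_g ?mule1//; first exact/measurable_EFinP.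
by move=> z _; rewrite lee_fin.
Qed.

Let inner_le c x : (\int[leb]_z (F c x z)%:E <= (\1_Lambda x)%:E)%E.
Proof. by rewrite -int_Lg; apply: ge0_integral_mono => z; rewrite lee_fin. Qed.

Let inner_ge0 c x : (0 <= \int[leb]_z (F c x z)%:E)%E.
Proof. by apply: integral_ge0 => z _; rewrite lee_fin. Qed.

Let measurable_inner c :
  measurable_fun [set: V] (fun x => \int[leb]_z (F c x z)%:E)%E.
Proof.
have Fe0 p : (0 <= (F c p.1 p.2)%:E)%E by rewrite lee_fin.
exact: (@measurable_fun_fubini_tonelli_F _ _ _ _ _ leb _ (mF c) Fe0).
Qed.

Lemma boundary_flux_ge0 c : (0 <= boundary_flux c)%E.
Proof. exact: integral_ge0. Qed.

Lemma boundary_flux_fin c : boundary_flux c \is a fin_num.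
Proof.
rewrite ge0_fin_numE ?boundary_flux_ge0//; apply: le_lt_trans Loo.
have <- : (\int[leb]_x (\1_Lambda x)%:E = leb Lambda)%E by rewrite integral_indic// setIT.
exact: ge0_integral_mono.
Qed.

(** Dominated convergence is applied twice: in [z] with bound [g], where the integrand is eventually
    0, then in [x] with bound the indicator of [Lambda], integrable because [Lambda] is bounded. *)
Lemma cvg_boundary_flux (c : R^nat) : c n @[n --> \oo] --> 0 ->
  boundary_flux (c n) @[n --> \oo] --> 0%E.
Proof.
move=> c0.
have mFx n x : measurable_fun [set: V] (fun z => (F (c n) x z)%:E).
  exact: (measurableT_comp (mF (c n)) (pair1_measurable x)).
have inner0 x : (\int[leb]_z (F (c n) x z)%:E)%E @[n --> \oo] --> 0%E.
  have := @dominated_convergence _ _ _ leb setT measurableT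
    (fun n z => (F (c n) x z)%:E) (cst 0%E) (fun z => (g z)%:E).
  rewrite integral0; case => //.
  - apply: aeW => z _.
    have [xL|xL] := pselect (Lambda x); last first.
      by apply: cvg_near_cst; apply: nearW => n; rewrite /F indicE memNset// !mul0r.
    apply: cvg_near_cst.
    have xcz : (x + c n *: z) @[n --> \oo] --> x.
      rewrite -[X in _ --> X](_ : x + 0 *: z = x); last by rewrite scale0r addr0.
      by apply: cvgD; [exact: cvg_cst|exact: cvgZr_tmp].
    have : \forall n \near \oo, Lambda (x + c n *: z).
      by apply: xcz; exact: open_nbhs_nbhs.
    apply: filterS => n Ln; rewrite /F [\1_(~` Lambda) _]indicE memNset.
      by rewrite mulr0 mul0r.
    exact.
  - apply/integrableP; split; first exact/measurable_EFinP.
    under eq_integral do rewrite gee0_abs ?lee_fin//.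
    by rewrite int_g ltry.
  - apply: aeW => z n _ /=; rewrite lee_fin ger0_norm//.
    by apply: le_trans (Fg _ _ _) _; rewrite ler_piMl// indicE; case: (_ \in _).
have := @dominated_convergence _ _ _ leb setT measurableT
  (fun n x => \int[leb]_z (F (c n) x z)%:E)%E (cst 0%E) (fun x => (\1_Lambda x)%:E).
rewrite integral0; case => //.
- by apply: aeW => x _; exact: inner0.
- apply/integrableP; split; first by apply/measurable_EFinP; exact: measurable_indic.
  under eq_integral do rewrite gee0_abs ?lee_fin//.
  by rewrite integral_indic// setIT.
- by apply: aeW => x n _; rewrite gee0_abs.
Qed.

(** Only the base point is rescaled, which gives the single factor [r ^+ d]. The displacement
    [z = y - x] keeps its scale, so [r^-1] reappears inside the indicator. *)
Lemma boundary_fluxE (k : V -> V -> R) (r : R) (A : set V) :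
  (forall x y, 0 <= k x y) ->
  {ae leb, forall x, {ae leb, forall y, k x y = g (y - x)}} ->
  0 < r -> A = [set r *: x | x in Lambda] ->
  (\int[leb]_x \int[leb]_y (\1_A x * \1_(~` A) y * k x y)%:E =
   (r ^+ d)%:E * boundary_flux r^-1)%E.
Proof.
move=> k0 kg r0 AE.
have A_scale y : A y <-> Lambda (r^-1 *: y).
  rewrite AE; split=> [[x Lx <-]|Ly].
    by rewrite scalerA mulVf ?gt_eqF// scale1r.
  by exists (r^-1 *: y) => //; rewrite scalerA divff ?gt_eqF// scale1r.
have A1 y : \1_A y = \1_Lambda (r^-1 *: y) :> R.
  by rewrite !indicE; congr ((_ : bool)%:R); apply/idP/idP; rewrite !inE => /A_scale.
have AC1 y : \1_(~` A) y = \1_(~` Lambda) (r^-1 *: y) :> R.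
  rewrite !indicE !in_setC; congr ((~~ (_ : bool))%:R).
  by apply/idP/idP; rewrite !inE => /A_scale.
pose h x := (\int[leb]_z (F r^-1 x z)%:E)%E.
have mh : measurable_fun [set: V] h.
  exact: measurable_inner.
have rV0 : 0 < r^-1 by rewrite invr_gt0.
have := ge0_integral_rV_affine 0 rV0 mh (inner_ge0 r^-1).
rewrite invrK /boundary_flux => <-.
have mhr : measurable_fun [set: V] (fun x => h (r^-1 *: x + 0)).
  by apply: (measurableT_comp mh); exact: measurable_affine.
(* Only the side written with [g] is known to be measurable, here and in the inner integral
   below. *)
apply: ge0_integral_ae_measurable => //.
- by move=> x; apply: integral_ge0 => y _; rewrite lee_fin !mulr_ge0.
- by move=> x; exact: inner_ge0.
apply: filterS kg => x kx; rewrite addr0 /h.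
have mFx : measurable_fun [set: V] (fun z => (F r^-1 (r^-1 *: x) z)%:E).
  exact: (measurableT_comp (mF r^-1) (pair1_measurable (r^-1 *: x))).
rewrite -(ge0_integral_shift (- x) mFx); last by move=> z; rewrite lee_fin.
apply: ge0_integral_ae_measurable.
- apply: (measurableT_comp mFx); apply: measurable_fun_addrV => //.
- by move=> y; rewrite lee_fin !mulr_ge0.
- by move=> y; rewrite lee_fin.
- apply: filterS kx => y ->; congr EFin; rewrite /F A1 AC1; congr (_ * \1__ _ * _).
  by rewrite -scalerDr addrC subrK.
Qed.

End boundary_flux.

(** * Dilated domains and the conclusion *)

(** A preimage gives measurability, and the summand 0 matches the shape of [lebesgue_rV_affine]. *)
Lemma image_scale_preimage (R : realType) (V : lmodType R) (r : R) (A : set V) :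
  0 < r -> [set r *: x | x in A] = (fun v => r^-1 *: v + 0) @^-1` A.
Proof.
move=> r0; apply/seteqP; split=> [_ [x Ax <-]|y] /=; rewrite addr0.
  by rewrite scalerA mulVf ?gt_eqF// scale1r.
by move=> Ay; exists (r^-1 *: y) => //; rewrite scalerA divff ?gt_eqF// scale1r.
Qed.

Lemma bounded_image_scale (R : realType) (V : normedModType R) (r : R) (A : set V) :
  0 < r -> bounded_set A -> bounded_set [set r *: x | x in A].
Proof.
move=> r0 [M [_ /(_ (M + 1))]]; rewrite ltrDl ltr01 => /(_ isT) AM.
exists (r * (M + 1)); split; first exact: num_real.
move=> N rN _ [x /AM/= Ax <-]; rewrite normrZ gtr0_norm//.
by apply: le_trans (ltW rN); rewrite ler_pM2l.
Qed.

Theorem proposition1p5 (R : realType) (d : nat)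
    (P : probability (configuration R d) R)
    (calK : ('rV[R]_d -> R[i]) -> ('rV[R]_d -> R[i]))
    (K : 'rV[R]_d -> 'rV[R]_d -> R[i])
    (Lambda : set 'rV[R]_d) :
  (0 < d)%N ->
  orthogonal_projection lebesgue_rV calK ->
  locally_trace_class calK ->
  projection_kernel calK K ->
  determinantal P K ->
  radial K ->
  (\forall x \ae @lebesgue_rV R d, K x x = 1) ->
  open Lambda -> bounded_set Lambda -> (0 < lebesgue_rV Lambda)%E ->
  'E_P[npoints [set r *: x | x in Lambda]]%E @[r --> +oo%R] --> +oo%E /\
  ('V_P[npoints [set r *: x | x in Lambda]] /
     'E_P[npoints [set r *: x | x in Lambda]])%E @[r --> +oo%R] --> 0%E.
Proof.
move=> d0 _ _ projK detP radK K1 oL bL L0.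
have mL : measurable Lambda by exact: measurable_mx_open.
have Lfin : lebesgue_rV Lambda \is a fin_num.
  by rewrite ge0_fin_numE//; exact: lebesgue_rV_bounded.
pose l := fine (lebesgue_rV Lambda).
have lE : lebesgue_rV Lambda = l%:E by rewrite fineK.
have l0 : 0 < l by rewrite -lte_fin -lE.
pose A r : set 'rV[R]_d := [set r *: x | x in Lambda].
have mA r : 0 < r -> measurable (A r).
  move=> r0; rewrite /A image_scale_preimage// -[X in measurable X]setTI.
  exact: measurable_affine.
have bA r : 0 < r -> bounded_set (A r) by move=> r0; exact: bounded_image_scale.
have EA r : 0 < r -> ('E_P[npoints (A r)] = (r ^+ d * l)%:E)%E.
  move=> r0; rewrite unlock (integral_npoints K1 detP (mA r r0) (bA r r0)).
  by rewrite /A image_scale_preimage// lebesgue_rV_affine ?invr_gt0// invrK lE EFinM.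
have [|g [mg g0 int_g kg]] := radial_density projK K1 radK.
  by apply: lt_le_trans L0 _; rewrite le_measure ?inE.
have VA r : 0 < r -> ('V_P[npoints (A r)] = (r ^+ d)%:E * boundary_flux g Lambda r^-1)%E.
  move=> r0; rewrite (variance_npoints projK K1 detP (mA r r0) (bA r r0)).
  by apply: boundary_fluxE => // x y; exact: sqr_ge0.
split.
  apply/cvgeyPge => M; near=> r.
  have r1 : 1 <= r by near: r; apply: nbhs_pinfty_ge; exact: num_real.
  rewrite EA; last exact: lt_le_trans r1.
  (* Since [r <= r ^+ d] for [r >= 1] and [d > 0], it suffices that [r] exceed [M / l]. *)
  rewrite lee_fin -ler_pdivrMr//; apply: (@le_trans _ _ r).
    by near: r; apply: nbhs_pinfty_ge; exact: num_real.
  by rewrite -[leLHS]expr1 ler_weXn2l.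
(* The limit is tested along sequences, the setting of dominated convergence. *)
apply/cvge_pinftyP => u uoo.
have u0 : \forall n \near \oo, 0 < u n by move/cvgryPgt : uoo => /(_ 0).
have uV : (u n)^-1 @[n --> \oo] --> 0 by apply/gtr0_cvgV0.
have flux0 : (boundary_flux g Lambda (u n)^-1 * l^-1%:E)%E @[n --> \oo] --> 0%E.
  rewrite -[X in _ --> X](mul0e l^-1%:E). 
  by apply: cvgeZr => //; exact: cvg_boundary_flux.
apply: cvg_trans flux0; apply: near_eq_cvg; apply: filterS u0 => n un0.
(* The mean is positive, so its inverse in [\bar R] is the real one and the powers of [u n]
   cancel. *)
rewrite -/(A (u n)) EA// VA// inver gt_eqF; last by rewrite mulr_gt0// exprn_gt0.
rewrite -(fineK (boundary_flux_fin mg g0 int_g oL bL _)) -!EFinM; congr EFin.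
by field; rewrite !gt_eqF// exprn_gt0.
Unshelve. all: end_near. Qed.
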